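(* There is an algorithm $\mathbb A$ such that on input a graph $G$, an integer $k\ge 3$, and $c\in \mathbb N$, the algorithm $\mathbb A$ computes a graph $G_c$ such that (i) if $G$ contains a clique of size $k$, then $\gamma(G_c)< 1.1\cdot d^c$; (ii) if $G$ contains no clique of size $k$, then $\gamma(G_c)> c\cdot d^c/3$, where $d= \left(30\cdot c^2\cdot (k+1)^2\right)^{4 k^3+ 3c}$. Moreover, the running time of $\mathbb A$ is bounded by $f(k,c)\cdot |G|^{O(c)}$ for some computable function $f: \mathbb N\times \mathbb N\to \mathbb N$.
   Context: Graphs are finite, simple and undirected; $|G|$ is the number of vertices plus edges. A dominating set of $G=(V,E)$ is a set $D\subseteq V$ such that every vertex of $V$ is in $D$ or adjacent to a vertex of $D$; $\gamma(G)$ is the minimum size of a dominating set of $G$. *)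

(* Defs.v *)
From mathcomp Require Import all_boot.
Set Implicit Arguments. Unset Strict Implicit. Unset Printing Implicit Defensive.

Record graph := Graph {
  gn : nat;
  gadj : rel 'I_gn;
  gsym : symmetric gadj;
  girr : irreflexive gadj }.

Definition gedges (G : graph) : {set 'I_(gn G) * 'I_(gn G)} :=
  [set p : 'I_(gn G) * 'I_(gn G) | (val p.1 < val p.2)%N && gadj p.1 p.2].
Definition gsize (G : graph) : nat := gn G + #|gedges G|.

Definition dominating (G : graph) (D : {set 'I_(gn G)}) : bool :=
  [forall v, (v \in D) || [exists u in D, gadj u v]].
(* minimum size of a dominating set (the whole vertex set, of size gn G,
   is always dominating, so gn G is a legitimate initial value) *)
Definition domnum (G : graph) : nat :=
  \big[minn/gn G]_(D : {set 'I_(gn G)} | dominating D) #|D|.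

Definition has_clique (G : graph) (k : nat) : Prop :=
  exists S : {set 'I_(gn G)}, #|S| = k /\
    {in S &, forall u v, u != v -> gadj u v}.

(* Model of computation: deterministic single-tape Turing machines    *)
(* over the tape alphabet {blank, 0, 1} (= option bool), with a finite *)
(* set of states and a one-way infinite tape (cells indexed by nat).   *)
Inductive dir := MoveL | MoveR | Stay.

Record TM := MkTM {
  tm_Q : finType;
  tm_start : tm_Q;
  (* None = halt *)
  tm_delta : tm_Q -> option bool -> option (tm_Q * option bool * dir) }.

Record config (M : TM) := Cfg {
  cf_state : tm_Q M;
  cf_pos : nat;
  cf_tape : nat -> option bool }.

Definition halted (M : TM) (c : config M) : bool :=
  if @tm_delta M (cf_state c) (cf_tape c (cf_pos c)) is None then true else false.

Definition step (M : TM) (c : config M) : config M :=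
  match @tm_delta M (cf_state c) (cf_tape c (cf_pos c)) with
  | None => c
  | Some (q', w, d) =>
      let p := cf_pos c in
      @Cfg M q'
        (match d with MoveL => p.-1 | MoveR => p.+1 | Stay => p end)
        (fun i => if i == p then w else cf_tape c i)
  end.

Definition init (M : TM) (x : seq bool) : config M :=
  @Cfg M (@tm_start M) 0 (fun i => nth None (map Some x) i).

Definition run (M : TM) (t : nat) (x : seq bool) : config M :=
  iter t (@step M) (init M x).

Definition tape_output (M : TM) (c : config M) (y : seq bool) : Prop :=
  (forall i, (i < size y)%N -> cf_tape c i = Some (nth false y i)) /\
  cf_tape c (size y) = None.

Definition outputs_within (M : TM) (x : seq bool) (t : nat) (y : seq bool) : Prop :=
  halted (run M t x) /\ tape_output (run M t x) y.

Definition enc_nat (k : nat) : seq bool := nseq k true ++ [:: false].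

Definition enc_graph (G : graph) : seq bool :=
  enc_nat (gn G) ++
  [seq gadj i j | i <- enum 'I_(gn G), j <- enum 'I_(gn G)].

Definition enc_input (G : graph) (k c : nat) : seq bool :=
  enc_graph G ++ enc_nat k ++ enc_nat c.

Definition computable2 (f : nat -> nat -> nat) : Prop :=
  exists Mf : TM, forall k c, exists t,
    outputs_within Mf (enc_nat k ++ enc_nat c) t (nseq (f k c) true).

Definition dpar (k c : nat) : nat :=
  (30 * c ^ 2 * (k + 1) ^ 2) ^ (4 * k ^ 3 + 3 * c).

(* Main.v *)
Require Import Defs.
From mathcomp Require Import all_boot zify.
From Stdlib Require Import FunctionalExtensionality.
Set Implicit Arguments. Unset Strict Implicit. Unset Printing Implicit Defensive.

(** Each pair (i, j) of clique positions is a colour, and a base vertex is a colour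
    together with a pair of graph vertices proposed for these positions (an edge, if
    i <> j); base vertices are pairwise adjacent. An element (b, p, F) with b < H = c k^2
    hashes pairs to a range of constant size q through the multiplier p, and F assigns a
    challenge to every tuple of hash values, one per colour; it is adjacent to the base
    vertices that answer the challenge of some tuple compatible with their hash.
    The k^2 base vertices of a clique answer every challenge. If fewer than H vertices
    dominate everything, some b does not occur among them and some p hashes them without
    collision; when there is no clique, each tuple has a challenge that they do not
    answer, and collecting these challenges into F gives an undominated element.
    Taking d^c / k^2 disjoint copies yields the gap.

    The construction is arithmetic on numbers that are quadratic in n up to a factor
    depending on k and c, hence a program on unary registers prints the graph within the
    required time once the constants are known, and the time needed for the constants,
    which enters f, is computed by a copy of that program counting its own steps. *)

(** The obstacle is the number of elements. A gap of factor c requires that some element defeat any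
    family of fewer than [H] base vertices, possibly with many vertices of one colour, so an element
    needs a separate challenge for each way of selecting one vertex per colour. Tables indexed by
    graph vertices would be exponentially many in n; indexed by hash values from a range depending
    on k and c only, their number is constant, and n enters only through the multiplier, which takes
    O(n^2) values up to a factor in k and c. A challenge names a position inside a colour and a hash
    value t: it is met by a pair of that colour whose coordinate at the position hashes to t, or by
    a pair of the diagonal colour of the position whose vertex does not. A clique vertex satisfies
    one or the other, whatever t is; conversely, pairs meeting all challenges must agree on their
    coordinates and so form a clique. One copy costs at most k^2 with a clique and at least [H] = c
    k^2 without one; the copies scale this to about d^c against c d^c. For c = 0 a single vertex is
    printed. *)

Definition upd (T : Type) (f : nat -> T) i x : nat -> T :=
  fun j => if j == i then x else f j.

Lemma upd_same T (f : nat -> T) i : upd f i (f i) = f.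
Proof. by apply: functional_extensionality => j; rewrite /upd; case: eqP => [->|]. Qed.

Lemma updd T (f : nat -> T) i x y : upd (upd f i x) i y = upd f i y.
Proof. by apply: functional_extensionality => j; rewrite /upd; case: eqP. Qed.

Lemma updE T (f : nat -> T) i x : upd f i x i = x.
Proof. by rewrite /upd eqxx. Qed.

(** * Zipper view of a Turing machine *)

Section Zipper.
Variables (Q : Type) (delta : Q -> option bool -> option (Q * option bool * dir)).

(* State, reversed left part of the tape, scanned symbol, right part padded with blanks. *)
Definition zconf := (Q * seq (option bool) * option bool * seq (option bool))%type.

(** With an empty left part a left move stays in place, which agrees with [p.-1] at cell 0 in
    [step]. *)
Definition zstep (z : zconf) : zconf :=
  let: (q, l, x, r) := z in
  match delta q x with
  | None => z
  | Some (q', w, MoveR) => (q', w :: l, head None r, behead r)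
  | Some (q', w, MoveL) =>
      if l is y :: l' then (q', l', y, w :: r) else (q', [::], w, r)
  | Some (q', w, Stay) => (q', l, w, r)
  end.

Definition zc (q : Q) l xs : zconf := (q, l, head None xs, behead xs).

End Zipper.

Lemma nth_head_behead (T : Type) (x0 : T) s : nth x0 (head x0 s :: behead s) =1 nth x0 s.
Proof. by case: s => [|y s] [|i] //=; rewrite nth_nil. Qed.

Section Repr.
Variable M : TM.

Definition represents (c : config M) (z : zconf (tm_Q M)) : Prop :=
  let: (q, l, x, r) := z in
  [/\ cf_state c = q, cf_pos c = size l & cf_tape c =1 nth None (catrev l (x :: r))].

Lemma nth_catrev_set l (x w : option bool) r i :
  (if i == size l then w else nth None (catrev l (x :: r)) i) =
  nth None (catrev l (w :: r)) i.
Proof.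
rewrite !catrevE !nth_cat size_rev; case: ltngtP => // h; last by rewrite h subnn.
by have -> : i - size l = (i - size l).-1.+1 by lia.
Qed.

Lemma represents_step c z :
  represents c z -> represents (step c) (zstep (@tm_delta M) z).
Proof.
case: z => [[[q l] x] r] [hq hp ht] /=.
have hx : cf_tape c (cf_pos c) = x.
  by rewrite ht hp catrevE nth_cat size_rev ltnn subnn.
rewrite /step hx hq; case E: (tm_delta q x) => [[[q' w] d]|]; last by split.
case: d {E}.
- case: l hp ht => [|y l] hp ht; (split=> //=; first by rewrite hp).
  + by move=> i; rewrite ht hp -(nth_catrev_set [::] x w).
  + by move=> i; rewrite ht hp (nth_catrev_set (y :: l) x w).
- split=> //=; first by rewrite hp.
  move=> i; rewrite ht hp nth_catrev_set /= !catrevE !nth_cat.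
  case: ifP => // _; case: (i - _) => [|j] //=; rewrite -/(nth _ (_ :: _)).
  exact: (esym (nth_head_behead None r j)).
- by split=> // i; rewrite /= ht hp nth_catrev_set.
Qed.

Lemma represents_iter t c z :
  represents c z -> represents (iter t (@step M) c) (iter t (zstep (@tm_delta M)) z).
Proof. by move=> h; elim: t => //= t; apply: represents_step. Qed.

End Repr.

(** * Programs on finitely many bit stacks *)

Definition state := nat -> seq bool.

Inductive instr :=
  | IPush of nat & bool & nat
  | IPop of nat & nat & nat & nat
  | IHalt.

Definition mstep (C : nat -> instr) (x : nat * state) : nat * state :=
  let: (l, st) := x in
  match C l with
  | IPush i b l' => (l', upd st i (b :: st i))
  | IPop i n n0 n1 =>
      if st i is b :: r then (if b then n1 else n0, upd st i r) else (n, st)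
  | IHalt => x
  end.

(* [Case i a b c] pops stack [i] and runs [a], [b] or [c] when it was empty,
   had [false] or had [true] on top; [While i a] pops stack [i] and runs [a] as
   long as it finds [true]. *)
Inductive stmt :=
  | Skip
  | Push of nat & bool
  | Seq of stmt & stmt
  | Case of nat & stmt & stmt & stmt
  | While of nat & stmt.

(** The times are exact instruction counts of the compiled code, not bounds: [Skip] and [Seq] cost
    nothing, every test of [Case] or [While] costs one. A [false] on top also ends a loop and is
    consumed; this is how the terminator of [enc_nat] is read. *)
Inductive exec : stmt -> state -> nat -> state -> Prop :=
  | XSkip s : exec Skip s 0 s
  | XPush i b s : exec (Push i b) s 1 (upd s i (b :: s i))
  | XSeq a b s t s' t' s'' :
      exec a s t s' -> exec b s' t' s'' -> exec (Seq a b) s (t + t') s''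
  | XCaseN i a b c s t s' :
      s i = [::] -> exec a s t s' -> exec (Case i a b c) s t.+1 s'
  | XCase i a b c s v r t s' :
      s i = v :: r -> exec (if v then c else b) (upd s i r) t s' ->
      exec (Case i a b c) s t.+1 s'
  | XWhileN i a s : s i = [::] -> exec (While i a) s 1 s
  | XWhileF i a s r : s i = false :: r -> exec (While i a) s 1 (upd s i r)
  | XWhileT i a s r t s' t' s'' :
      s i = true :: r -> exec a (upd s i r) t s' ->
      exec (While i a) s' t' s'' -> exec (While i a) s (t + t').+1 s''.

Fixpoint below N (s : stmt) : bool :=
  match s with
  | Skip => true
  | Push i _ => i < N
  | Seq a b => below N a && below N b
  | Case i a b c => [&& i < N, below N a, below N b & below N c]
  | While i a => (i < N) && below N a
  end.

Lemma below_leq N N' s : N <= N' -> below N s -> below N' s.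
Proof.
move=> le; elim: s => //= [i _|a iha b ihb|i a iha b ihb c ihc|i a iha].
- by lia.
- by case/andP => /iha-> /ihb->.
- by case/and4P => h /iha-> /ihb-> /ihc->; rewrite !andbT; lia.
- by case/andP => h /iha->; rewrite andbT; lia.
Qed.

Lemma ex_below s : exists N, below N s.
Proof.
elim: s => [|i b|a [N1 h1] b [N2 h2]|i a [N1 h1] b [N2 h2] c [N3 h3]|i a [N1 h1]] /=.
- by exists 0.
- by exists i.+1.
- by exists (N1 + N2); rewrite (below_leq _ h1) ?(below_leq _ h2) //; lia.
- exists (i.+1 + N1 + N2 + N3).
  by rewrite (below_leq _ h1) ?(below_leq _ h2) ?(below_leq _ h3) //; lia.
- by exists (i.+1 + N1); rewrite (below_leq _ h1) //; lia.
Qed.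

(* Code [C] entered at label [l] implements [s] and leaves towards label [l']. *)
Fixpoint implements (C : nat -> instr) (l : nat) (s : stmt) (l' : nat) : Prop :=
  match s with
  | Skip => l = l'
  | Push i b => C l = IPush i b l'
  | Seq a b => exists2 m, implements C l a m & implements C m b l'
  | Case i a b c => exists n n0 n1, [/\ C l = IPop i n n0 n1,
      implements C n a l', implements C n0 b l' & implements C n1 c l']
  | While i a => exists2 m, C l = IPop i l' l' m & implements C m a l
  end.

Lemma implements_exec C s st t st' l l' :
  exec s st t st' -> implements C l s l' -> iter t (mstep C) (l, st) = (l', st').
Proof.
move=> h; elim: h l l' => {s st t st'}.
- by move=> s l l' /= ->.
- by move=> i b s l l' /= ->.
- move=> a b s t s' t' s'' _ iha _ ihb l l' /= [m /iha ha /ihb hb].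
  by rewrite addnC iterD ha hb.
- move=> i a b c s t s' hs _ ih l l' /= [n [n0 [n1 [hC h _ _]]]].
  by rewrite -iterS iterSr /= hC hs; apply: ih.
- move=> i a b c s v r t s' hs _ ih l l' /= [n [n0 [n1 [hC _ h0 h1]]]].
  by rewrite -iterS iterSr /= hC hs; apply: ih; case: (v).
- by move=> i a s hs l l' /= [m -> _]; rewrite hs.
- by move=> i a s r hs l l' /= [m -> _]; rewrite hs.
- move=> i a s r t s' t' s'' hs _ iha _ ihw l l' /= [m hC h].
  rewrite -iterS iterSr addnC iterD /= hC hs (iha _ _ h).
  by apply: ihw => /=; exists m.
Qed.

Definition instr_ok N L (x : instr) :=
  match x with
  | IPush i _ l => (i < N) && (l <= L)
  | IPop i n n0 n1 => [&& i < N, n <= L, n0 <= L & n1 <= L]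
  | IHalt => true
  end.

Lemma instr_ok_leq N L L' x : L <= L' -> instr_ok N L x -> instr_ok N L' x.
Proof. by case: x => //= *; lia. Qed.

(** Code is produced backwards from its exit label: the second half of a sequence comes first, and
    its entry is the exit of the first half; the body of a loop exits to the test. Quantifying over
    every [C] that contains the segment at [base] lets segments be concatenated. The label bound [L]
    later makes the state set finite. *)
Lemma compile s N base ex : below N s ->
  exists (code : seq instr) (entry L : nat),
   [/\ ex <= L, entry <= L, all (instr_ok N L) code &
   forall C, (forall i, i < size code -> C (base + i) = nth IHalt code i) ->
     implements C entry s ex].
Proof.
elim: s base ex => [|i b|a iha b ihb|i a iha b ihb c ihc|i a iha] base ex /=.
- by move=> _; exists [::], ex, ex.
- move=> hi; exists [:: IPush i b ex], base, (base + ex); split=> //=; try lia.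
  by move=> C /(_ 0 isT); rewrite addn0.
- case/andP=> ha hb.
  have [cb [eb [Lb [h1 h2 h3 h4]]]] := ihb base ex hb.
  have [ca [ea [La [h5 h6 h7 h8]]]] := iha (base + size cb) eb ha.
  exists (cb ++ ca), ea, (La + Lb); split; try lia.
  + rewrite all_cat (sub_all _ h3) ?(sub_all _ h7) // => x; apply: instr_ok_leq; lia.
  + move=> C hC; exists eb.
    * apply: h8 => j hj; rewrite -addnA hC ?size_cat; last by lia.
      by rewrite nth_cat ltnNge leq_addr /= addKn.
    * by apply: h4 => j hj; rewrite hC ?size_cat ?nth_cat ?hj //; lia.
- case/and4P=> hi ha hb hc.
  have [ca [ea [La [h1 h2 h3 h4]]]] := iha base.+1 ex ha.
  have [cb [eb [Lb [h5 h6 h7 h8]]]] := ihb (base.+1 + size ca) ex hb.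
  have [cc [ec [Lc [h9 h10 h11 h12]]]] := ihc (base.+1 + size ca + size cb) ex hc.
  exists (IPop i ea eb ec :: ca ++ cb ++ cc), base, (base + La + Lb + Lc).
  split=> //=; try lia.
  + rewrite !all_cat (sub_all _ h3) ?(sub_all _ h7) ?(sub_all _ h11) ?andbT;
    try by move=> x; apply: instr_ok_leq; lia.
    by apply/and4P; split=> //; lia.
  + move=> C hC; exists ea, eb, ec; split.
    * by have := hC 0 isT; rewrite addn0.
    * apply: h4 => j hj; rewrite addSnnS hC /= ?size_cat; last by lia.
      by rewrite nth_cat hj.
    * apply: h8 => j hj; rewrite -addnA addSnnS hC /= ?size_cat; last by lia.
      by rewrite nth_cat ltnNge leq_addr /= addKn nth_cat hj.
    * apply: h12 => j hj; rewrite -!addnA addSnnS hC /= ?size_cat; last by lia.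
      by rewrite nth_cat ltnNge leq_addr /= addKn nth_cat ltnNge leq_addr /= addKn.
- case/andP=> hi ha.
  have [ca [ea [La [h1 h2 h3 h4]]]] := iha base.+1 base ha.
  exists (IPop i ex ex ea :: ca), base, (ex + base + La); split=> //=; try lia.
  + rewrite (sub_all _ h3) ?andbT; last by move=> x; apply: instr_ok_leq; lia.
    by apply/and4P; split=> //; lia.
  + move=> C hC; exists ea; first by have := hC 0 isT; rewrite addn0.
    by apply: h4 => j hj; rewrite addSnnS hC.
Qed.

(** * Bit stacks on a single tape *)

(* The tape holds the stacks one after the other, each preceded by a blank. *)
Definition blocks (ss : seq (seq bool)) : seq (option bool) :=
  flatten [seq None :: map Some s | s <- ss].

Definition tape_of N (st : state) := blocks (mkseq st N).

Notation blanks := (count_mem (None : option bool)).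

Lemma blanks_some s : blanks (map Some s) = 0.
Proof. by elim: s. Qed.

Lemma blanks_blocks ss : blanks (blocks ss) = size ss.
Proof. by elim: ss => //= s ss ih; rewrite count_cat blanks_some ih. Qed.

Lemma blocks_cat s1 s2 : blocks (s1 ++ s2) = blocks s1 ++ blocks s2.
Proof. by rewrite /blocks map_cat flatten_cat. Qed.

Lemma mkseq_upd_split N st i : i < N -> exists s1 s2,
  [/\ size s1 = i, size s2 = N.-1 - i & forall v : seq bool, mkseq (upd st i v) N = s1 ++ v :: s2].
Proof.
move=> hi; exists (mkseq st i), (mkseq (fun j => st (i.+1 + j)) (N.-1 - i)).
rewrite !size_mkseq; split=> // v.
apply: (@eq_from_nth _ [::]); first by rewrite size_cat /= !size_mkseq; lia.
rewrite size_mkseq => j hj; rewrite nth_mkseq // nth_cat size_mkseq /upd.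
case: (ltngtP j i) => h; last by rewrite h subnn.
- by rewrite nth_mkseq.
- have -> : j - i = (j - i.+1).+1 by lia.
  by rewrite /= nth_mkseq; [congr st|]; lia.
Qed.

Section Machine.
Variables (C : nat -> instr) (N L entry : nat).

Definition raw := (nat * nat * nat * nat * option bool)%type.

(** [Seek] finds the separator of a stack; [Ins] and [Shl] move everything behind it one cell to the
    right or left, holding the displaced symbol in the state; [Chk] tests for emptiness, [GoEnd]
    reaches the end, [Ret] returns to cell 0. [HGo] and [HShl] remove the leading blank before
    halting. *)
Definition Seek l c : raw := (0, l, c, 0, None).
Definition Ins l c b y : raw := (1, l, c, b, y).
Definition Ret l c : raw := (2, l, c, 0, None).
Definition Chk l : raw := (3, l, 0, 0, None).
Definition GoEnd l c : raw := (4, l, c, 0, None).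
Definition Shl l c y : raw := (5, l, c, 0, y).
Definition HGo : raw := (6, 0, 0, 0, None).
Definition HShl y : raw := (7, 0, 0, 0, y).
Definition Hlt : raw := (8, 0, 0, 0, None).

Definition target l := match C l with IPush i _ _ => i | IPop i _ _ _ => i | IHalt => 0 end.
Definition start l := Seek l (target l).

(* Counters count the blanks still to be crossed: separators, plus the first
   blank behind the last stack where the head turns round. *)
Definition rdelta (r : raw) (x : option bool) : option (raw * option bool * dir) :=
  let: (ph, l, a, b, y) := r in
  match ph with
  | 0 => match x, a with
    | Some _, _ => Some (Seek l a, x, MoveR)
    | None, a'.+1 => Some (Seek l a', x, MoveR)
    | None, 0 => match C l with
      | IPush i v l' => Some (Ins l' (N.-1 - i) N (Some v), x, MoveR)
      | IPop _ _ _ _ => Some (Chk l, x, MoveR)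
      | IHalt => Some (HGo, x, MoveR)
      end
    end
  | 1 => match x, a with
    | Some _, _ => Some (Ins l a b x, y, MoveR)
    | None, a'.+1 => Some (Ins l a' b x, y, MoveR)
    | None, 0 => Some (Ret l b, y, MoveR)
    end
  | 2 => match x, a with
    | Some _, _ => Some (Ret l a, x, MoveL)
    | None, a'.+1 => Some (Ret l a', x, MoveL)
    | None, 0 => Some (start l, x, Stay)
    end
  | 3 => if C l is IPop i n _ _ then
      if x is None then Some (Ret n i, x, MoveL) else Some (GoEnd l (N.-1 - i), x, MoveR)
    else None
  | 4 => match x, a with
    | Some _, _ => Some (GoEnd l a, x, MoveR)
    | None, a'.+1 => Some (GoEnd l a', x, MoveR)
    | None, 0 => Some (Shl l (N - target l) None, x, Stay)
    end
  | 5 => match x, a with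
    | Some _, _ => Some (Shl l a x, y, MoveL)
    | None, a'.+1 => Some (Shl l a' x, y, MoveL)
    | None, 0 => if C l is IPop i _ n0 n1 then
        Some (Ret (if y == Some true then n1 else n0) i, x, Stay) else None
    end
  | 6 => if x is None then Some (HShl None, x, MoveL) else Some (HGo, x, MoveR)
  | 7 => if x is None then Some (Hlt, y, Stay) else Some (HShl x, y, MoveL)
  | _ => None
  end.

Notation zs := (zstep rdelta).

Lemma run_seek l xs lf ys :
  iter (size xs) zs (zc (Seek l (blanks xs)) lf (xs ++ ys)) = zc (Seek l 0) (catrev xs lf) ys.
Proof. by elim: xs lf => [|[v|] xs ih] lf //; rewrite iterSr -ih. Qed.

Lemma run_ins l xs lf b y :
  iter (size xs).+1 zs (zc (Ins l (blanks xs) b y) lf xs) = (Ret l b, catrev xs (y :: lf), None, [::]).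
Proof. by elim: xs lf y => [|[v|] xs ih] lf y //; rewrite iterSr -ih. Qed.

(** There is no end marker on the left, so cell 0 is recognised by counting blanks. It holds the
    first separator, hence the hypothesis on [last]: as long as the head has not arrived, a blank
    lies ahead and the counter cannot run out early. *)
Lemma run_ret l ly x r : last x ly = None ->
  exists xs, catrev (x :: ly) r = None :: xs /\
  iter (size ly).+1 zs (Ret l (blanks (x :: ly)).-1, ly, x, r) = (start l, [::], None, xs).
Proof.
elim: ly x r => [|y ly ih] x r /= hl.
  by exists r; rewrite hl.
have [xs [h1 h2]] := ih y (x :: r) hl.
exists xs; split=> //; rewrite -iterS iterSr -h2 /=; congr (zs (iter _ _ _)).
case: x {h1 h2} => [v|] //=; rewrite ?add0n ?add1n //=.
have : 0 < (y == None) + blanks ly.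
  by elim: ly y hl {ih r} => [|z ly ih] y /=; [move=> -> | move=> /ih h; rewrite addn_gt0 h orbT].
by case: (_ + _).
Qed.

Lemma run_goend l xs lf :
  iter (size xs) zs (zc (GoEnd l (blanks xs)) lf xs) = zc (GoEnd l 0) (catrev xs lf) [::].
Proof. by elim: xs lf => [|[v|] xs ih] lf //; rewrite iterSr -ih. Qed.

Lemma run_shl l ls lf x y r :
  iter (size ls).+1 zs (Shl l (blanks (x :: ls)) y, ls ++ None :: lf, x, r) =
  (Shl l 0 (last x ls), lf, None, rev (belast x ls) ++ y :: r).
Proof.
elim: ls x y r => [|z ls ih] x y r; first by case: x.
by rewrite iterSr /= rev_cons cat_rcons -ih; case: x.
Qed.

Lemma run_hgo s lf ys :
  iter (size s) zs (zc HGo lf (map Some s ++ ys)) = zc HGo (catrev (map Some s) lf) ys.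
Proof. by elim: s lf => [|v s ih] lf //; rewrite iterSr -ih. Qed.

Lemma run_hshl s y r :
  iter (size s).+1 zs (HShl y, behead (map Some s ++ [:: None]), head None (map Some s ++ [:: None]), r)
  = (Hlt, [::], last y (map Some s), rev (belast y (map Some s)) ++ r).
Proof.
elim: s y r => [|v s ih] y r //.
rewrite iterSr [belast _ _]/= rev_cons cat_rcons [last _ _]/= -ih; congr (iter _ _ _).
by case: s {ih}.
Qed.

Definition home l st : zconf raw := (start l, [::], None, behead (tape_of N st)).

Lemma tape_of_head st : 0 < N -> tape_of N st = None :: behead (tape_of N st).
Proof. by rewrite /tape_of /mkseq; case: N. Qed.

(** The insertion sweep stops on the first blank behind the last stack. That cell becomes an
    explicit trailing blank of the zipper; the tape function does not see it. *)
Lemma run_push l i b l' st : i < N -> C l = IPush i b l' ->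
  exists t xs, [/\ t <= 4 * size (tape_of N st) + 10,
   iter t zs (home l st) = (start l', [::], None, xs) &
   None :: xs =  tape_of N (upd st i (b :: st i)) ++ [:: None]].
Proof.
move=> hi hC.
have [s1 [s2 [z1 z2 hs]]] := mkseq_upd_split st hi.
have e1 : tape_of N st = blocks s1 ++ None :: map Some (st i) ++ blocks s2.
  by rewrite /tape_of -[in LHS](upd_same st i) hs blocks_cat.
have e2 : tape_of N (upd st i (b :: st i)) =
    blocks s1 ++ None :: Some b :: map Some (st i) ++ blocks s2.
  by rewrite /tape_of hs blocks_cat.
set xs := map Some (st i) ++ blocks s2 in e1 e2.
have b2 : blanks xs = N.-1 - i by rewrite count_cat blanks_some blanks_blocks.
have b1 : blanks (blocks s1) = i by rewrite blanks_blocks.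
have h0 : home l st = zc (Seek l (blanks (blocks s1))) [::] (blocks s1 ++ None :: xs).
  by rewrite -e1 b1 /home /start /target hC /zc (tape_of_head st) //; lia.
set lf := catrev xs (Some b :: None :: catrev (blocks s1) [::]).
have elf : lf = rev (tape_of N (upd st i (b :: st i))).
  by rewrite /lf e2 !catrevE rev_cat !rev_cons cats0 !cat_rcons.
have hl : last None lf = None.
  rewrite elf (tape_of_head _); last by lia.
  by rewrite rev_cons last_rcons.
have [ys [h1 h2]] := run_ret l' [::] hl.
exists (size lf + 1 + (size xs + 1) + 1 + size (blocks s1)), ys; split.
- have -> : size lf = size (blocks s1) + 2 + size xs by rewrite elf size_rev e2 size_cat /=; clear; lia.
  rewrite e1 size_cat /=; clear; lia.
- rewrite iterD h0 run_seek iterD.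
  rewrite [iter 1 zs _]/= hC -b2 -/(zc _ _ _) iterD.
  rewrite [size xs + 1]addn1 (run_ins l' xs (None :: catrev (blocks s1) [::]) N (Some b)) -/lf.
  rewrite addn1 -h2; congr (iter _ _ (Ret l' _, _, _, _)).
  rewrite [blanks _]/= elf; have /permP-> := permEl (perm_rev (tape_of N (upd st i (b :: st i)))).
  by rewrite blanks_blocks size_mkseq.
- by rewrite -h1 elf /= catrevE revK.
Qed.

Lemma run_pop_empty l i n n0 n1 st : i < N -> C l = IPop i n n0 n1 -> st i = [::] ->
  exists t xs e, [/\ t <= 4 * size (tape_of N st) + 10,
   iter t zs (home l st) = (start n, [::], None, xs) &
   None :: xs = tape_of N st ++ nseq e None].
Proof.
move=> hi hC hst.
have [s1 [s2 [z1 z2 hs]]] := mkseq_upd_split st hi.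
have e1 : tape_of N st = blocks s1 ++ None :: blocks s2.
  by rewrite /tape_of -[in LHS](upd_same st i) hs blocks_cat hst.
have b1 : blanks (blocks s1) = i by rewrite blanks_blocks.
have h0 : home l st = zc (Seek l (blanks (blocks s1))) [::] (blocks s1 ++ None :: blocks s2).
  by rewrite -e1 b1 /home /start /target hC /zc (tape_of_head st) //; lia.
set lf := catrev (blocks s1) [::].
have elf : lf = rev (blocks s1) by rewrite /lf catrevE cats0.
have hl : last None lf = None.
  rewrite elf; case: (s1) => //= s s1'.
  by rewrite rev_cons last_rcons.
have [ys [h1 h2]] := run_ret n (None :: behead (blocks s2)) hl.
(* The cell inspected after the separator lies beyond the represented tape exactly when stack [i] is
   the last one. *)
exists ((size lf).+1 + 1 + 1 + size (blocks s1)), ys, (s2 == [::]); split.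
- rewrite e1 elf size_rev !size_cat /=; clear; lia.
- rewrite iterD h0 run_seek iterD [iter 1 zs _]/= hC -/lf.
  rewrite iterD [iter 1 zs _]/= hC.
  have -> : head None (blocks s2) = None by case: (s2).
  rewrite -h2; congr (iter _ _ (Ret _ _, _, _, _)).
  rewrite [blanks _]/= elf; have /permP-> := permEl (perm_rev (blocks s1)).
  by rewrite b1.
- rewrite -h1 e1 -catA /= elf catrevE revK; congr (_ ++ _ :: _).
  by case: (s2) => //= s s2'; rewrite cats0.
Qed.

(** The leftward sweep picks up each symbol and drops it one cell further left, so on reaching the
    separator the symbol in hand is the popped bit, which selects the next label. *)
Lemma run_pop l i n n0 n1 st b r : i < N -> C l = IPop i n n0 n1 -> st i = b :: r ->
  exists t xs e, [/\ t <= 4 * size (tape_of N st) + 10,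
   iter t zs (home l st) = (start (if b then n1 else n0), [::], None, xs) &
   None :: xs = tape_of N (upd st i r) ++ nseq e None].
Proof.
move=> hi hC hst.
have [s1 [s2 [z1 z2 hs]]] := mkseq_upd_split st hi.
have e1 : tape_of N st = blocks s1 ++ None :: Some b :: map Some r ++ blocks s2.
  by rewrite /tape_of -[in LHS](upd_same st i) hs blocks_cat hst.
have e2 : tape_of N (upd st i r) = blocks s1 ++ None :: map Some r ++ blocks s2.
  by rewrite /tape_of hs blocks_cat.
set xs := map Some r ++ blocks s2 in e1 e2.
have b1 : blanks (blocks s1) = i by rewrite blanks_blocks.
have b2 : blanks xs = N.-1 - i by rewrite count_cat blanks_some blanks_blocks.
have h0 : home l st = zc (Seek l (blanks (blocks s1))) [::] (blocks s1 ++ None :: Some b :: xs).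
  by rewrite -e1 b1 /home /start /target hC /zc (tape_of_head st) //; lia.
set lf := catrev (blocks s1) [::].
have elf : lf = rev (blocks s1) by rewrite /lf catrevE cats0.
have hl : last None lf = None.
  rewrite elf; case: (s1) => //= s s1'.
  by rewrite rev_cons last_rcons.
set ls := rcons (rev xs) (Some b).
have bls : blanks (None :: ls) = N - i.
  rewrite [blanks _]/= /ls -cats1 count_cat /=; have /permP-> := permEl (perm_rev xs).
  by rewrite b2; lia.
have [ys [h1 h2]] := run_ret (if b then n1 else n0) (rev (belast None ls) ++ [:: None]) hl.
exists ((size lf).+1 + 1 + (size ls).+1 + 1 + size xs + 1 + 1 + size (blocks s1)), ys, 2; split.
- have -> : size lf = size (blocks s1) by rewrite elf size_rev.
  have -> : size ls = (size xs).+1 by rewrite size_rcons size_rev.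
  rewrite e1 size_cat /=; clear; lia.
- rewrite iterD h0 run_seek iterD [iter 1 zs _]/= hC -/lf.
  rewrite iterD [iter 1 zs _]/= hC -b2 -/(zc _ _ _) iterD run_goend.
  rewrite iterD [iter 1 zs _]/= {1}/target hC -bls.
  rewrite iterD (_ : catrev xs _ = ls ++ None :: lf); last first.
    by rewrite /ls cat_rcons catrevE.
  rewrite run_shl iterD [iter 1 zs _]/= hC -h2.
  have -> : last None ls = Some b by rewrite last_rcons.
  rewrite (_ : i = (blanks (None :: lf)).-1); last first.
    by rewrite [blanks _]/= elf; have /permP-> := permEl (perm_rev (blocks s1)).
  by case: (b).
- rewrite -h1 e2 -catA elf /= catrevE revK /ls belast_rcons rev_cons revK.
  by rewrite cat_rcons.
Qed.

(** The raw input has no leading separator, so the machine starts by inserting a blank in front of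
    it. The separators of the other, empty stacks are blanks that the tape already contains. *)
Lemma run_init s : exists xs e, 
  iter ((size s).+1 + (size s).+2) zs (zc (Ins entry 0 1 None) [::] (map Some s)) =
   (start entry, [::], None, xs) /\
  None :: xs = None :: map Some s ++ nseq e None.
Proof.
set lf := catrev (map Some s) [:: None].
have elf : lf = rev (None :: map Some s) by rewrite /lf catrevE rev_cons cats1.
have hl : last None lf = None by rewrite elf rev_cons last_rcons.
have [ys [h1 h2]] := run_ret entry [::] hl.
exists ys, 1; split.
  have := run_ins entry (map Some s) [::] 1 None.
  rewrite blanks_some size_map addnC iterD -/lf => ->; rewrite -h2.
  rewrite (_ : size lf = (size s).+1); last by rewrite elf size_rev /= size_map.
  congr (iter _ _ (Ret _ _, _, _, _)).
  rewrite [blanks _]/= elf; have /permP-> := permEl (perm_rev (None :: map Some s)).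
  by rewrite /= blanks_some.
by rewrite -h1 /= elf catrevE revK.
Qed.

(** [tape_output] expects the output at cell 0, so stack 0 is shifted over its own separator. *)
Lemma run_halt l st : 0 < N -> C l = IHalt ->
  exists t x xs r, [/\ t <= 4 * size (tape_of N st) + 10,
   iter t zs (home l st) = (Hlt, [::], x, xs) &
   x :: xs = map Some (st 0) ++ None :: r].
Proof.
move=> hN hC.
have [s1 [s2 [/size0nil es1 z2 hs]]] := mkseq_upd_split st hN.
have e1 : tape_of N st = None :: map Some (st 0) ++ blocks s2.
  by rewrite /tape_of -[in LHS](upd_same st 0) hs es1.
have h0 : home l st = (Seek l 0, [::], None, map Some (st 0) ++ blocks s2).
  by rewrite /home /start /target hC e1.
set ls := map Some (rev (st 0)) ++ [:: None].
exists ((size (rev (st 0))).+1 + 1 + size (st 0) + 1).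
exists (last None (map Some (rev (st 0)))).
exists (rev (belast None (map Some (rev (st 0)))) ++ None :: behead (blocks s2)).
exists (None :: behead (blocks s2)); split.
- rewrite e1 size_rev /= size_cat size_map; lia.
- rewrite iterD h0 [iter 1 zs _]/= hC iterD -/(zc HGo [:: None] _) run_hgo.
  have -> : catrev (map Some (st 0)) [:: None] = ls by rewrite catrevE -map_rev.
  rewrite -run_hshl iterD; congr (iter _ _ _); rewrite /= /zc.
  have -> : head None (blocks s2) = None by case: (s2).
  by rewrite /ls; case: (rev _).
- by rewrite -cat_cons -rev_rcons -lastI rev_cons -map_rev revK; rewrite cat_rcons.
Qed.

End Machine.

(** * Finite state set, and simulation of stack programs with quadratic overhead *)

Section MachineTM.
Variables (code : seq instr) (N L entry : nat).
Hypotheses (code_ok : all (instr_ok N L) code) (entry_le : entry <= L) (N_gt0 : 0 < N).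

Let C := nth IHalt code.
Let B := N + L.

Lemma C_ok l : instr_ok N L (C l).
Proof.
rewrite /C; case: (ltnP l (size code)) => h; last by rewrite nth_default.
exact: (all_nthP IHalt code_ok).
Qed.

Definition raw_ok (r : raw) :=
  let: (ph, l, a, b, _) := r in [&& ph <= B + 8, l <= B + 8, a <= B + 8 & b <= B + 8].

Definition tmQ : finType := ('I_(B + 9) * 'I_(B + 9) * 'I_(B + 9) * 'I_(B + 9) * option bool)%type.

Definition inB (x : nat) : 'I_(B + 9) := cast_ord (esym (addnS B 8)) (inord x).

Definition pack (r : raw) : tmQ :=
  let: (ph, l, a, b, y) := r in (inB ph, inB l, inB a, inB b, y).
Definition unpack (q : tmQ) : raw :=
  let: (ph, l, a, b, y) := q in (val ph, val l, val a, val b, y).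

Lemma packK r : raw_ok r -> unpack (pack r) = r.
Proof.
by case: r => [[[[ph l] a] b] y] /and4P[h1 h2 h3 h4]; rewrite /= !inordK ?ltnS.
Qed.

Lemma rdelta_ok r x r' w d : raw_ok r -> rdelta C N r x = Some (r', w, d) -> raw_ok r'.
Proof.
case: r => [[[[ph l] a] b] y] /and4P[h1 h2 h3 h4].
have := C_ok l; rewrite /B in h1 h2 h3 h4 *.
have target_le l' : target C l' <= N + L + 8.
  by rewrite /target; have := C_ok l'; case: (C l') => //= *; lia.
move=> hC; have := C_ok l; rewrite -/C.
case: ph h1 => [|[|[|[|[|[|[|[|ph]]]]]]]] h1 //=.
all: case: x => [v|] //=; try (case: a h3 => [|a] h3 //=).
all: try case: (C l) => [i v' l'|i n n0 n1|] //= hi.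
all: try by case=> <- _ _ /=; try case: ifP => _; lia.
all: by case=> <- _ _ /=; have := target_le l; lia.
Qed.

Definition machine : TM :=
  @MkTM tmQ (pack (Ins entry 0 1 None))
    (fun q x => omap (fun p => (pack p.1.1, p.1.2, p.2)) (rdelta C N (unpack q) x)).

Lemma machine_deltaE q x : raw_ok q -> @tm_delta machine (pack q) x =
  omap (fun p => (pack p.1.1, p.1.2, p.2)) (rdelta C N q x).
Proof. by move=> ok; rewrite -{2}(packK ok). Qed.

Definition zpack (z : zconf raw) : zconf tmQ :=
  let: (q, l, x, r) := z in (pack q, l, x, r).

Lemma zstep_pack z : raw_ok z.1.1.1 ->
  zstep (@tm_delta machine) (zpack z) = zpack (zstep (rdelta C N) z) /\
  raw_ok (zstep (rdelta C N) z).1.1.1.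
Proof.
case: z => [[[q l] x] r] hq; rewrite /= in hq.
have -> : zstep (@tm_delta machine) (zpack (q, l, x, r)) =
  match rdelta C N q x with
  | None => zpack (q, l, x, r)
  | Some (q', w, MoveR) => (pack q', w :: l, head None r, behead r)
  | Some (q', w, MoveL) =>
      if l is y :: l' then (pack q', l', y, w :: r) else (pack q', [::], w, r)
  | Some (q', w, Stay) => (pack q', l, w, r)
  end.
  rewrite /zstep /zpack machine_deltaE //.
  by case: (rdelta C N q x) => [[[q' w] d]|].
rewrite /zstep; case E: (rdelta C N q x) => [[[q' w] d]|] //.
have ok := rdelta_ok hq E.
by case: d {E} => //; case: l.
Qed.

Lemma iter_pack t z : raw_ok z.1.1.1 ->
  iter t (zstep (@tm_delta machine)) (zpack z) = zpack (iter t (zstep (rdelta C N)) z) /\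
  raw_ok (iter t (zstep (rdelta C N)) z).1.1.1.
Proof.
move=> ok; elim: t => [|t [ih1 ih2]] //=.
by rewrite ih1; have [-> ?] := zstep_pack ih2.
Qed.

Lemma represents_pad c q xs T e : 0 < size T -> head None T = None ->
  @represents machine c (q, [::], None, xs) -> None :: xs = T ++ nseq e None ->
  @represents machine c (q, [::], None, behead T).
Proof.
case: T => // x T _ /= -> [h1 h2 h3] [E]; split=> // i; rewrite h3 /= E.
case: i => [|i] //=; rewrite nth_cat; case: ltnP => // hi.
by rewrite nth_nseq if_same nth_default.
Qed.

Definition tsize (st : state) := size (tape_of N st).

Lemma tsize_upd st i (s : seq bool) : i < N ->
  tsize (upd st i s) + size (st i) = tsize st + size s.
Proof.
move=> hi; have [s1 [s2 [_ _ hs]]] := mkseq_upd_split st hi.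
have e1 : tape_of N st = blocks (s1 ++ st i :: s2).
  by rewrite /tape_of -[in LHS](upd_same st i) hs.
rewrite /tsize e1 /tape_of hs.
rewrite !blocks_cat -![blocks (_ :: s2)]/(None :: map Some _ ++ blocks s2).
by rewrite !size_cat /= !size_cat !size_map; lia.
Qed.

Lemma raw_ok_start l : l <= L -> raw_ok (start C l).
Proof.
move=> hl; rewrite /raw_ok /start /target; have := C_ok l.
by case: (C l) => //= *; rewrite /B; lia.
Qed.

Lemma simulate_instr c l st : l <= L -> C l <> IHalt ->
  @represents machine c (zpack (home C N l st)) ->
  exists t, [/\ t <= 4 * tsize st + 10,
    @represents machine (iter t (@step machine) c)
      (zpack (home C N (mstep C (l, st)).1 (mstep C (l, st)).2)),
    (mstep C (l, st)).1 <= L & tsize (mstep C (l, st)).2 <= (tsize st).+1].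
Proof.
move=> hl hC hc.
have main t xs e l' st' : 
   iter t (zstep (rdelta C N)) (home C N l st) = (start C l', [::], None, xs) ->
   None :: xs = tape_of N st' ++ nseq e None ->
   @represents machine (iter t (@step machine) c) (zpack (home C N l' st')).
  move=> h1 h2; have := represents_iter t hc.
  have [-> _] := iter_pack t (raw_ok_start hl : raw_ok (home C N l st).1.1.1).
  rewrite h1 => h3; apply: represents_pad h3 h2; by rewrite tape_of_head.
rewrite [mstep _ _]/=; have := C_ok l; case E: (C l) hC => [i v l'|i n n0 n1|] //= _.
  case/andP=> hi hl'.
  have [t [xs [h1 h2 h3]]] := run_push st hi E.
  exists t; split=> //; first by apply: main h2 (h3 : _ = _ ++ nseq 1 None).
  by have := tsize_upd st (v :: st i) hi; rewrite /=; lia.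
case/and4P=> hi hn h0 h1.
case hst: (st i) => [|b r] /=.
  have [t [xs [e [h2 h3 h4]]]] := run_pop_empty hi E hst.
  by exists t; split=> //; apply: main h3 h4.
have [t [xs [e [h2 h3 h4]]]] := run_pop hi E hst.
exists t; split=> //; first by apply: main h3 h4.
  by case: (b).
by have := tsize_upd st r hi; rewrite hst /=; lia.
Qed.

(** An instruction costs a bounded number of sweeps over the tape and lengthens it by at most one
    cell, whence the quadratic time. *)
Lemma simulate t c l st : l <= L ->
  @represents machine c (zpack (home C N l st)) ->
  exists t', [/\ t' <= t * (4 * (tsize st + t) + 10),
    @represents machine (iter t' (@step machine) c)
      (zpack (home C N (iter t (mstep C) (l, st)).1 (iter t (mstep C) (l, st)).2)),
    (iter t (mstep C) (l, st)).1 <= L & tsize (iter t (mstep C) (l, st)).2 <= tsize st + t].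
Proof.
elim: t c l st => [|t ih] c l st hl hc; first by exists 0; split=> //=; lia.
have [hC|hC] : C l = IHalt \/ C l <> IHalt by case: (C l); [right|right|left].
  exists 0; suff -> : iter t.+1 (mstep C) (l, st) = (l, st) by split=> //=; lia.
  by elim: (t.+1) => //= u ->; rewrite /= hC.
have [t1 [h1 h2 h3 h4]] := simulate_instr hl hC hc.
rewrite iterSr; case: (mstep C (l, st)) h2 h3 h4 => l' st' /= h2 h3 h4.
have [t2 [h5 h6 h7 h8]] := ih _ _ _ h3 h2.
exists (t2 + t1); rewrite iterD; split=> //; last by lia.
have : t * (4 * (tsize st' + t) + 10) <= t * (4 * (tsize st + t.+1) + 10).
  by rewrite leq_mul2l; apply/orP; right; lia.
by rewrite mulSn; lia.
Qed.

Definition input_state (x : seq bool) : state := upd (fun _ => [::]) 0 x.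

Lemma tsize_input x : tsize (input_state x) = N + size x.
Proof.
have := tsize_upd (fun _ => [::]) x N_gt0; rewrite addn0 => ->; congr (_ + _).
rewrite /tsize /tape_of; elim: N => [|n ih] //.
by rewrite mkseqS -cats1 blocks_cat size_cat ih addn1.
Qed.

Lemma tape_of_input x : tape_of N (input_state x) = None :: map Some x ++ nseq N.-1 None.
Proof.
have aux n m : 0 < m -> blocks [seq input_state x i | i <- iota m n] = nseq n None.
  by elim: n m => [|n ih] [|m] //= _; rewrite -(ih m.+2).
rewrite /tape_of; case: N N_gt0 => // n _.
by rewrite -(aux n 1).
Qed.

Lemma machine_outputs x t l st : C l = IHalt ->
  iter t (mstep C) (entry, input_state x) = (l, st) ->
  exists t', t' <= (t + 2) * (4 * (N + size x + t) + 14) /\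
   outputs_within machine x t' (st 0).
Proof.
move=> hC ht.
have r0 : @represents machine (init machine x)
    (zpack (zc (Ins entry 0 1 None) [::] (map Some x))).
  by split=> // i; rewrite /= nth_head_behead.
have ok0 : raw_ok (zc (Ins entry 0 1 None) [::] (map Some x)).1.1.1.
  by rewrite /= /B; lia.
have [xs [e [h1 h2]]] := run_init C N entry x.
set t0 := _ + _ in h1.
have := represents_iter t0 r0; have [-> _] := iter_pack t0 ok0; rewrite h1 => r1.
have r2 : @represents machine (iter t0 (@step machine) (init machine x))
   (zpack (home C N entry (input_state x))).
  rewrite /home tape_of_input.
  case: r1 => e1 e2 e3; split=> // i; rewrite e3 /=; case: h2 => ->.
  case: i => [|i] //=; rewrite !nth_cat; case: ifP => //.
  by rewrite !nth_nseq !if_same.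
have [t1 [h3 h4 h5 h6]] := simulate t entry_le r2; rewrite ht in h4 h5 h6.
rewrite /= in h5 h6.
have {}h4 : @represents machine _ (zpack (home C N l st)) := h4.
have [t2 [y [ys [r [h7 h8 h9]]]]] := run_halt st N_gt0 hC.
have := represents_iter t2 h4.
have [-> _] := iter_pack t2 (raw_ok_start h5 : raw_ok (home C N l st).1.1.1).
rewrite h8 => r3; exists (t2 + (t1 + t0)); split.
  rewrite -/(tsize st) in h7; rewrite tsize_input in h3 h6; rewrite /t0.
  have : t1 <= t * (4 * (N + size x + t) + 14) by apply: leq_trans h3 _; rewrite leq_mul2l; lia.
  set W := _ + 14 => h10; have eW : W = 4 * (N + size x + t) + 14 by [].
  rewrite mulnDl; move: (t * W) h10 => tW h10; lia.
rewrite /outputs_within /run iterD [iter (t1 + t0) _ _]iterD.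
case: r3 => e1 e2 e3; split.
  rewrite /halted e1 machine_deltaE //.
  by rewrite /raw_ok /Hlt /= leq_addl.
split=> [i hi|]; rewrite e3 /= h9 nth_cat size_map.
  by rewrite hi (nth_map false).
by rewrite ltnn subnn.
Qed.

End MachineTM.

Lemma outputs_within_leq M x t t' y : t <= t' ->
  outputs_within M x t y -> outputs_within M x t' y.
Proof.
move=> le [h1 h2]; suff E : run M t' x = run M t x by rewrite /outputs_within E.
rewrite /run -(subnK le) iterD -/(run M t x); elim: (_ - _) => //= u ->.
by move: h1; rewrite /halted /step; case: (tm_delta _ _).
Qed.

Theorem stmt_machine s : exists (M : TM) (A : nat), forall x t st,
  exec s (input_state x) t st -> outputs_within M x (A * (size x + t).+1 ^ 2) (st 0).
Proof.
have [N' hN'] := ex_below s; set N := N'.+1.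
have hN : below N s by apply: below_leq hN'; rewrite /N.
have [code [entry [L [_ h2 h3 h4]]]] := compile 1 0 hN.
(* Label 0 is the halting instruction, and therefore the code was compiled at base 1 with exit 0. *)
pose cd := IHalt :: code.
have himp : implements (nth IHalt cd) entry s 0 by apply: h4 => i hi; rewrite add1n.
exists (machine cd N L entry), (32 * N.+1) => x t st /implements_exec/(_ himp) ht.
have [t' [h5 h6]] := @machine_outputs cd N L entry h3 h2 isT x t 0 st erefl ht.
apply: outputs_within_leq h6; apply: leq_trans h5 _.
rewrite expnS expn1; set a := (size x + t).+1.
have h7 : t + 2 <= 2 * a by rewrite /a; lia.
have h8 : 4 * (N + size x + t) + 14 <= 16 * N.+1 * a.
  have h9 : N <= N * a by apply: leq_pmulr.
  by rewrite -mulnA mulSn; move: (N * a) h9 => u; rewrite /a; lia.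
apply: leq_trans (leq_mul h7 h8) _.
by rewrite (_ : _ * _ = 32 * N.+1 * (a * a)) // ; lia.
Qed.

(** * Registers *)

Definition valuation := nat -> nat.

(* Stack 0 is the input and the output, stacks 1, 2 and 4 are scratch space, stack 3
   holds a read-only bit list, and the remaining stacks are registers in unary. *)
Definition regs (O X Y M : seq bool) (rho : valuation) : state := fun i =>
  match i with
  | 0 => O | 1 => X | 2 => Y | 3 => M | 4 => [::]
  | i'.+1.+4 => nseq (rho i') true
  end.

Notation reg x := (x.+1.+4).

Lemma regs_upd O X Y M rho x v :
  upd (regs O X Y M rho) (reg x) (nseq v true) = regs O X Y M (upd rho x v).
Proof.
apply: functional_extensionality => -[|[|[|[|[|z]]]]] //.
by rewrite /upd /= !eqSS; case: eqP.
Qed.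

Ltac ext_upd :=
  let u := fresh "u" in
  apply: functional_extensionality => u; rewrite /upd;
  repeat (case: eqP => //); intros; subst; try lia.

Ltac upd_lia := rewrite /upd; repeat (case: eqP => //); intros; subst; try lia.

Lemma exec_cast s st st1 t t' st' st1' :
  exec s st t st' -> st = st1 -> t = t' -> st' = st1' -> exec s st1 t' st1'.
Proof. by move=> h <- <- <-. Qed.

Lemma exec_while i a n (stk : nat -> state) (tm : nat -> nat) :
  (forall j, j < n -> exists2 r, stk j i = true :: r &
     exec a (upd (stk j) i r) (tm j) (stk j.+1)) ->
  stk n i = [::] ->
  exec (While i a) (stk 0) ((\sum_(j < n) (tm j).+1).+1) (stk n).
Proof.
elim: n stk tm => [|n ih] stk tm h hn.
  by rewrite big_ord0; apply: XWhileN.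
have [r h1 h2] := h 0 isT.
rewrite big_ord_recl addSn -addnS; apply: XWhileT h1 h2 _.
by apply: (ih (fun j => stk j.+1) (fun j => tm j.+1)) => // j hj; apply: h.
Qed.

Lemma exec_while_reg x a n O X Y M (rh : nat -> valuation) (tm : nat -> nat) :
  (forall j, j <= n -> rh j x = n - j) ->
  (forall j, j < n -> exec a (regs O X Y M (upd (rh j) x (n - j.+1))) (tm j) (regs O X Y M (rh j.+1))) ->
  exec (While (reg x) a) (regs O X Y M (rh 0)) ((\sum_(j < n) (tm j).+1).+1) (regs O X Y M (rh n)).
Proof.
move=> h1 h2; apply: (@exec_while _ _ _ (fun j => regs O X Y M (rh j))); last first.
  by rewrite /= h1 // subnn.
move=> j hj; exists (nseq (n - j.+1) true); last by rewrite regs_upd; apply: h2.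
by rewrite /= h1 ?(ltnW hj) //; have -> : n - j = (n - j.+1).+1 by lia.
Qed.

Lemma exec_push x O X Y M rho :
  exec (Push (reg x) true) (regs O X Y M rho) 1 (regs O X Y M (upd rho x (rho x).+1)).
Proof. by rewrite -regs_upd; apply: XPush. Qed.

Definition clear_reg x := While (reg x) Skip.
Definition move_reg x y := While (reg x) (Push (reg y) true).

Lemma exec_clear x O X Y M rho :
  exec (clear_reg x) (regs O X Y M rho) (rho x).+1 (regs O X Y M (upd rho x 0)).
Proof.
apply: exec_cast (@exec_while_reg x Skip (rho x) O X Y M
  (fun j => upd rho x (rho x - j)) (fun _ => 0) _ _) _ _ _.
- by move=> j _; rewrite updE.
- by move=> j hj; rewrite updd; apply: XSkip.
- by rewrite subn0 upd_same.
- by rewrite sum1_card card_ord.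
- by rewrite subnn.
Qed.

Lemma exec_move x y O X Y M rho : x != y ->
  exec (move_reg x y) (regs O X Y M rho) (2 * rho x).+1
    (regs O X Y M (upd (upd rho x 0) y (rho y + rho x))).
Proof.
move=> /eqP ne.
apply: exec_cast (@exec_while_reg x _ (rho x) O X Y M
  (fun j => upd (upd rho x (rho x - j)) y (rho y + j)) (fun _ => 1) _ _) _ _ _.
- by move=> j _; rewrite /upd eqxx; case: eqP.
- move=> j hj; apply: exec_cast (exec_push _ _ _ _ _ _) _ _ _ => //.
  congr regs; ext_upd.
- by congr regs; ext_upd.
- by rewrite sum_nat_const card_ord; lia.
- by rewrite subnn.
Qed.

Definition copy x d := Seq (While (reg x) (Seq (Push (reg d.+1) true) (Push (reg d) true)))
  (move_reg d.+1 x).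

Lemma exec_copy x d O X Y M rho : x < d -> rho d = 0 -> rho d.+1 = 0 ->
  exec (copy x d) (regs O X Y M rho) ((3 * rho x).+1 + (2 * rho x).+1)
    (regs O X Y M (upd rho d (rho x))).
Proof.
move=> lt z1 z2.
apply: XSeq; last first.
  apply: exec_cast (exec_move O X Y M (upd (upd (upd rho x 0) d (rho x)) d.+1 (rho x)) _) _ _ _;
    [|by []|by rewrite updE|congr regs; ext_upd].
  by lia.
apply: exec_cast (@exec_while_reg x _ (rho x) O X Y M
  (fun j => upd (upd (upd rho x (rho x - j)) d j) d.+1 j) (fun _ => 2) _ _) _ _ _.
- by move=> j _; rewrite /upd eqxx; do 2 (case: eqP => [?|_]; first lia).
- move=> j hj; rewrite -[2]/(1 + 1); apply: XSeq; first exact: exec_push.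
  apply: exec_cast (exec_push _ _ _ _ _ _) _ _ _ => //.
  congr regs; ext_upd.
- by congr regs; ext_upd.
- by rewrite sum_nat_const card_ord; lia.
- by rewrite subnn.
Qed.

(** * Computable functions of the registers *)

Definition fn := seq bool -> valuation -> nat.

Definition local d (f : fn) := forall M rho rho', (forall x, x < d -> rho x = rho' x) ->
  f M rho = f M rho'.

(** The base [B + 2] is at least 2, so constants and sums are absorbed by raising the exponent. The
    bound is uniform in the bit list: only register contents matter. *)
Definition pbound D (F : fn) := exists a, forall M rho B, (forall x, x < D -> rho x <= B) ->
  F M rho <= (B + 2) ^ a.

Definition computes D s (f T : fn) := forall O X Y M rho, (forall x, D <= x -> rho x = 0) ->
  exec s (regs O X Y M rho) (T M rho) (regs O X Y M (upd rho D (f M rho))).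

(* Constants depending only on [k] and [c] are handled with [p = false], whatever
   depends on the input graph with [p = true]. *)
Definition cmp (p : bool) d (f : fn) := local d f /\ forall D, d <= D ->
  exists s T, computes D s f T /\ (p -> pbound D T /\ pbound D f).

Lemma cmp_mono p d d' f : d <= d' -> cmp p d f -> cmp p d' f.
Proof.
move=> le [h1 h2]; split; last by move=> D hD; apply: h2; lia.
by move=> M rho rho' h; apply: h1 => x hx; apply: h; lia.
Qed.

Lemma pbound_le D F G : (forall M rho, F M rho <= G M rho) -> pbound D G -> pbound D F.
Proof. by move=> h [a ha]; exists a => M rho B /(ha M) hB; apply: leq_trans (h _ _) hB. Qed.

Lemma pow_ge2 B a b : a <= b -> (B + 2) ^ a <= (B + 2) ^ b.
Proof. by move=> h; rewrite leq_pexp2l //; lia. Qed.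

Lemma pbound_add D F G : pbound D F -> pbound D G -> pbound D (fun M rho => F M rho + G M rho).
Proof.
move=> [a ha] [b hb]; exists (a + b).+1 => M rho B hB.
have h1 := leq_trans (ha M _ _ hB) (pow_ge2 B (leq_addr b a)).
have h2 := leq_trans (hb M _ _ hB) (pow_ge2 B (leq_addl a b)).
rewrite expnS; apply: leq_trans (leq_add h1 h2) _.
by rewrite addnn -mul2n leq_mul2r leq_addl orbT.
Qed.

Lemma pbound_mul D F G : pbound D F -> pbound D G -> pbound D (fun M rho => F M rho * G M rho).
Proof.
move=> [a ha] [b hb]; exists (a + b) => M rho B hB.
by rewrite expnD; apply: leq_mul; [apply: ha|apply: hb].
Qed.

Lemma pbound_const D c : pbound D (fun _ _ => c).
Proof.
exists c => M rho B _; apply: leq_trans (ltnW (ltn_expl c (isT : 1 < 2))) _.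
by case: c => // c; rewrite leq_exp2r // leq_addl.
Qed.

Lemma pbound_S D F : pbound D F -> pbound D (fun M rho => (F M rho).+1).
Proof. by move=> h; apply: pbound_le (pbound_add h (pbound_const D 1)) => M rho; rewrite addn1. Qed.

Lemma pbound_var D x : x < D -> pbound D (fun _ rho => rho x).
Proof. by move=> h; exists 1 => M rho B hB; rewrite expn1; have := hB x h; lia. Qed.

Lemma pow_comp B a b : ((B + 2) ^ a + 2) ^ b <= (B + 2) ^ (a.+2 * b).
Proof.
case: b => [|b]; first by rewrite muln0.
rewrite expnM leq_exp2r // !expnS.
have : 0 < (B + 2) ^ a by rewrite expn_gt0 addn2.
move: (_ ^ a) => u hu; apply: (@leq_trans (2 * (2 * u))); first by lia.
by rewrite !leq_mul //; lia.
Qed.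

Lemma pbound_comp D D' F (V : seq bool -> valuation -> valuation) :
  (exists a, forall M rho B, (forall x, x < D -> rho x <= B) -> forall x, x < D' ->
    V M rho x <= (B + 2) ^ a) ->
  pbound D' F -> pbound D (fun M rho => F M (V M rho)).
Proof.
move=> [a ha] [b hb]; exists (a.+2 * b) => M rho B hB.
by apply: leq_trans (hb M _ _ (ha M _ _ hB)) (pow_comp _ _ _).
Qed.

Lemma pbound_upd D F f : pbound D f -> pbound D.+1 F ->
  pbound D (fun M rho => F M (upd rho D (f M rho))).
Proof.
move=> [a ha]; apply: pbound_comp; exists a.+1 => M rho B hB x hx.
have h1 : B <= (B + 2) ^ a.+1.
  by rewrite expnS; apply: leq_trans (leq_pmulr _ _); rewrite ?expn_gt0; lia.
rewrite /upd; case: eqP => hxD; last by apply: leq_trans (hB x _) h1; lia.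
by apply: leq_trans (ha M _ _ hB) (pow_ge2 _ _).
Qed.

Lemma cmp_ext p d f g : (forall M rho, f M rho = g M rho) -> cmp p d f -> cmp p d g.
Proof.
move=> h; suff -> : f = g by [].
by apply: functional_extensionality => M; apply: functional_extensionality.
Qed.

Lemma cmp_var p d x : x < d -> cmp p d (fun _ rho => rho x).
Proof.
move=> hx; split=> [M rho rho' h|D hD]; first exact: h.
exists (copy x D), (fun _ rho => (3 * rho x).+1 + (2 * rho x).+1); split.
  by move=> O X Y M rho z; apply: exec_copy; rewrite ?z //; lia.
move=> _; have hb : pbound D (fun _ rho => rho x) by apply: pbound_var; lia.
by split=> //; apply: pbound_add; apply: pbound_S; apply: pbound_mul => //; apply: pbound_const.
Qed.

Lemma cmp_S p d f : cmp p d f -> cmp p d (fun M rho => (f M rho).+1).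
Proof.
move=> [lf cf]; split=> [M rho rho' h|D hD]; first by rewrite (lf M _ _ h).
have [s [T [h1 h2]]] := cf D hD.
exists (Seq s (Push (reg D) true)), (fun M rho => T M rho + 1); split.
  move=> O X Y M rho z; apply: XSeq (h1 O X Y M rho z) _.
  by apply: exec_cast (exec_push _ _ _ _ _ _) _ _ _ => //; rewrite updE updd.
move=> /h2[b1 b2]; split; last exact: pbound_S.
by apply: pbound_add => //; apply: pbound_const.
Qed.

Lemma cmp_const p d c : cmp p d (fun _ _ => c).
Proof.
elim: c => [|c ih]; last exact: (cmp_S ih).
split=> // D hD; exists Skip, (fun _ _ => 0); split.
  move=> O X Y M rho z; apply: exec_cast (XSkip _) _ _ _ => //.
  by rewrite -(z D (leqnn D)) upd_same.
by move=> _; split; apply: pbound_const.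
Qed.

(* The let-bound value lives in a register above those of the context. *)
Lemma cmp_let_top p d f (g : seq bool -> valuation -> nat -> nat) :
  (forall v, local d (fun M rho => g M rho v)) ->
  (forall D, d <= D -> cmp p D.+1 (fun M rho => g M rho (rho D))) ->
  cmp p d f -> cmp p d (fun M rho => g M rho (f M rho)).
Proof.
move=> lg cg [lf cf]; split.
  by move=> M rho rho' h; rewrite (lf M _ _ h); apply: lg.
move=> D hD; have [s [T [h1 h2]]] := cf D hD.
have [s' [T' [h3 h4]]] := (cg D hD).2 D.+1 (leqnn _).
have eg M rho v : g M (upd rho D v) v = g M rho v.
  by apply: lg => x hx; rewrite /upd; case: eqP => // ?; lia.
exists (Seq s (Seq s' (Seq (clear_reg D) (move_reg D.+1 D)))).
exists (fun M rho => T M rho + (T' M (upd rho D (f M rho)) + ((f M rho).+1 + (2 * g M rho (f M rho)).+1))).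
split.
  move=> O X Y M rho z; apply: XSeq (h1 _ _ _ _ _ z) _.
  apply: XSeq; first apply: h3.
    by move=> x hx; rewrite /upd; case: eqP => [?|_]; [lia|apply: z; lia].
  rewrite /= updE eg; apply: XSeq.
    apply: exec_cast (exec_clear _ _ _ _ _ _) _ _ _; [reflexivity| |reflexivity].
    by rewrite /upd eqxx; case: eqP => // ?; lia.
  apply: exec_cast (exec_move _ _ _ _ _ _) _ _ _; [by lia|reflexivity| |].
    by rewrite /upd eqxx; do ?case: eqP => // ?; lia.
  have z1 := z D.+1 (leqnSn D); have z0 := z D (leqnn D); congr regs; ext_upd.
move=> hp; have [b1 b2] := h2 hp; have [b3 b4] := h4 hp.
have b5 : pbound D (fun M rho => g M rho (f M rho)).
  apply: pbound_le (pbound_upd b2 b4) => M rho; by rewrite updE eg.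
split=> //.
apply: pbound_add => //; apply: pbound_add; first by apply: pbound_upd.
apply: pbound_add; apply: pbound_S => //.
by apply: pbound_mul => //; apply: pbound_const.
Qed.

Lemma pbound_mono D D' F : D <= D' -> pbound D F -> pbound D' F.
Proof. by move=> le [a ha]; exists a => M rho B hB; apply: ha => x hx; apply: hB; lia. Qed.

(** A polynomially bounded loop body may still blow up under iteration, for instance by repeated
    squaring. Hence [G], which has to dominate every intermediate accumulator; it is asked for only
    when [p] holds. *)
Lemma cmp_rec p d n f0 (h : seq bool -> valuation -> nat -> nat -> nat) G :
  (forall i a, local d (fun M rho => h M rho i a)) ->
  (forall D, d <= D -> cmp p D.+3 (fun M rho => h M rho (rho D.+1) (rho D.+2))) ->
  (p -> pbound d G /\ forall M rho i, i <= n M rho -> iteri i (h M rho) (f0 M rho) <= G M rho) ->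
  cmp p d n -> cmp p d f0 -> cmp p d (fun M rho => iteri (n M rho) (h M rho) (f0 M rho)).
Proof.
move=> lh ch hG [ln cn] [l0 c0]; split.
  move=> M rho rho' e; rewrite (ln M _ _ e) (l0 M _ _ e); apply: eq_iteri => i a.
  exact: lh.
move=> D hD; have [sn [Tn [n1 n2]]] := cn D hD.
have [s0 [T0 [z1 z2]]] := c0 D.+2 (leqW (leqW hD)).
have [s2 [T2 [h1 h2]]] := (ch D hD).2 D.+3 (leqnn _).
pose acc M rho j := iteri j (h M rho) (f0 M rho).
(* Invariant after [j] rounds: remaining rounds in [D], index in [D.+1], accumulator in [D.+2]. *)
pose rh M rho j := upd (upd (upd rho D (n M rho - j)) D.+1 j) D.+2 (acc M rho j).
pose rh' M rho j := upd (rh M rho j) D (n M rho - j.+1).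
pose body := Seq s2 (Seq (clear_reg D.+2) (Seq (move_reg D.+3 D.+2) (Push (reg D.+1) true))).
pose tb M rho j := T2 M (rh' M rho j) + ((acc M rho j).+1 + ((2 * acc M rho j.+1).+1 + 1)).
exists (Seq sn (Seq s0 (Seq (While (reg D) body) (Seq (clear_reg D.+1) (move_reg D.+2 D))))).
exists (fun M rho => Tn M rho + (T0 M (upd (upd rho D (n M rho)) D.+1 0) +
   ((\sum_(j < n M rho) (tb M rho j).+1).+1 + ((n M rho).+1 + (2 * acc M rho (n M rho)).+1)))).
split.
  move=> O X Y M rho z.
  have zD x : D <= x -> rho x = 0 by exact: z.
  have z0 := z D (leqnn _); have z1' := z D.+1 (leqnSn _).
  have z2' : rho D.+2 = 0 by apply: z; lia.
  have z3' : rho D.+3 = 0 by apply: z; lia.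
  apply: XSeq (n1 _ _ _ _ _ z) _.
  apply: XSeq.
    have -> : upd (upd rho D (n M rho)) D.+1 0 = upd rho D (n M rho) by ext_upd.
    by apply: z1 => x hx; rewrite /upd; case: eqP => [?|_]; [lia|apply: z; lia].
  apply: XSeq.
    apply: exec_cast (@exec_while_reg D body (n M rho) O X Y M (rh M rho) (tb M rho) _ _) _ _ _;
      [| | |reflexivity|reflexivity].
    - by move=> j _; rewrite /rh /upd; do !(case: eqP => ?; first by lia).
    - move=> j hj; rewrite -/(rh' M rho j).
      have zr : forall x, D.+3 <= x -> rh' M rho j x = 0.
        by move=> x hx; rewrite /rh' /rh /upd; do !(case: eqP => ?; first by lia); apply: z; lia.
      have e1 : h M (rh' M rho j) (rh' M rho j D.+1) (rh' M rho j D.+2) = acc M rho j.+1.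
        have -> : rh' M rho j D.+1 = j by rewrite /rh' /rh; upd_lia.
        have -> : rh' M rho j D.+2 = acc M rho j by rewrite /rh' /rh; upd_lia.
        by apply: lh => x hx; rewrite /rh' /rh /upd; do !(case: eqP => ?; first by lia).
      have e2 : rh' M rho j D.+2 = acc M rho j by rewrite /rh' /rh; upd_lia.
      apply: XSeq; first exact: h1.
      rewrite /= e1; apply: XSeq.
        apply: exec_cast (exec_clear _ _ _ _ _ _) _ _ _; [reflexivity| |reflexivity].
        by rewrite /upd -/(rh' M rho j) e2; case: eqP => // ?; lia.
      apply: XSeq.
        apply: exec_cast (exec_move _ _ _ _ _ _) _ _ _; [by lia|reflexivity| |reflexivity].
        by rewrite /upd eqxx; do ?case: eqP => // ?; lia.
      apply: exec_cast (exec_push _ _ _ _ _ _) _ _ _ => //.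
      congr regs; rewrite /rh' /rh; ext_upd.
    - by congr regs; rewrite /rh /acc (l0 M (upd rho D (n M rho)) rho) ?subn0 /=;
        [ext_upd|move=> x hx; rewrite /upd; case: eqP => // ?; lia].
  apply: XSeq.
    apply: exec_cast (exec_clear _ _ _ _ _ _) _ _ _; [reflexivity| |reflexivity].
    by rewrite /rh; upd_lia.
  apply: exec_cast (exec_move _ _ _ _ _ _) _ _ _; [by lia|reflexivity| |].
    by rewrite /rh; upd_lia.
  by congr regs; rewrite /rh; ext_upd; rewrite subnn.
move=> hp; have [bn bn'] := n2 hp; have [b0 b0'] := z2 hp; have [b2 b2'] := h2 hp.
have [/(pbound_mono hD) bG leG] := hG hp.
have bacc F : (forall M rho, F M rho <= n M rho) -> pbound D (fun M rho => acc M rho (F M rho)).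
  by move=> hF; apply: pbound_le bG => M rho; apply: leG.
split; last exact: (bacc n).
have bT2 : pbound D (fun M rho => \max_(j < n M rho) T2 M (rh' M rho j)).
  have [a ha] := pbound_add bn' bG; have [b hb] := b2.
  exists (a.+3 * b) => M rho B hB; apply/bigmax_leqP => j _.
  apply: leq_trans (hb M _ ((B + 2) ^ a.+1) _) (pow_comp _ _ _) => x hx.
  have := ha M rho B hB; have := pow_ge2 B (leqnSn a).
  have := pow_ge2 B (isT : 1 <= a.+1); rewrite expn1.
  have := leG M rho j (ltnW (ltn_ord j)); rewrite -/(acc M rho j).
  have := ltn_ord j; move: (_ ^ a) (_ ^ a.+1) (hB x) => u v hBx.
  rewrite /rh' /rh /upd; do !case: eqP => ?; try lia.
apply: pbound_add => //; apply: pbound_add.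
  apply: (pbound_upd (F := fun M rho => T0 M (upd rho D.+1 0)) bn').
  exact: pbound_upd (pbound_const _ 0) b0.
apply: pbound_add; last first.
  apply: pbound_add; apply: pbound_S => //; apply: pbound_mul; first exact: pbound_const.
  exact: bacc.
apply: pbound_S.
apply: (@pbound_le _ _ (fun M rho => n M rho *
    ((\max_(j < n M rho) T2 M (rh' M rho j)) + (3 * G M rho + 4)))); last first.
  apply: pbound_mul => //; apply: pbound_add => //; apply: pbound_add; last exact: pbound_const.
  by apply: pbound_mul => //; apply: pbound_const.
move=> M rho; rewrite -[X in _ <= X * _]card_ord -sum_nat_const.
apply: leq_sum => j _; rewrite /tb.
have := leq_bigmax (F := fun i : 'I_(n M rho) => T2 M (rh' M rho i)) j.
have := leG M rho j (ltnW (ltn_ord j)); have := leG M rho j.+1 (ltn_ord j).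
rewrite -/(acc M rho j) -/(acc M rho j.+1).
move: (\max_(_ < _) _) (T2 _ _) => u v; lia.
Qed.

Lemma cmp_let p d f (g : seq bool -> valuation -> nat -> nat) :
  (forall v, local d (fun M rho => g M rho v)) ->
  (forall D x, d <= D -> x < D -> cmp p D (fun M rho => g M rho (rho x))) ->
  cmp p d f -> cmp p d (fun M rho => g M rho (f M rho)).
Proof. by move=> lg cg; apply: cmp_let_top => // D hD; apply: cg; lia. Qed.

Lemma cmp_op1 p (g : nat -> nat) :
  (forall d x, x < d -> cmp p d (fun _ rho => g (rho x))) ->
  forall d f, cmp p d f -> cmp p d (fun M rho => g (f M rho)).
Proof. by move=> h d f; apply: (cmp_let (g := fun _ _ v => g v)) => // D x _; apply: h. Qed.

(** The arguments are let-bound first, so an operation need only be treated on registers, where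
    locality and bounds are immediate. *)
Lemma cmp_op2 p (g : nat -> nat -> nat) :
  (forall d x y, x < d -> y < d -> cmp p d (fun _ rho => g (rho x) (rho y))) ->
  forall d f1 f2, cmp p d f1 -> cmp p d f2 -> cmp p d (fun M rho => g (f1 M rho) (f2 M rho)).
Proof.
move=> h d f1 f2 c1 c2.
apply: (cmp_let (g := fun M rho v => g v (f2 M rho))) => // [v M rho rho' e|D x hD hx].
  by rewrite (c2.1 M _ _ e).
apply: (cmp_let (g := fun M rho v => g (rho x) v)); last exact: cmp_mono c2.
  by move=> v M rho rho' e; rewrite e.
by move=> D' y hD' hy; apply: h => //; lia.
Qed.

Lemma cmp_pred p d f : cmp p d f -> cmp p d (fun M rho => (f M rho).-1).
Proof.
move: d f; apply: cmp_op1 => d x hx.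
apply: cmp_ext (@cmp_rec p d (fun _ rho => rho x) (fun _ _ => 0) (fun _ _ i _ => i)
  (fun _ rho => rho x) _ _ _ _ _) => //.
- by move=> _ rho; case: (rho x).
- by move=> D hD; apply: cmp_var; lia.
- by move=> _; split; [apply: pbound_var|move=> M rho [|i] //= /ltnW].
- exact: cmp_var.
- exact: cmp_const.
Qed.

Lemma iteri_iter n (g : nat -> nat) a : iteri n (fun=> g) a = iter n g a.
Proof. by elim: n => //= n ->. Qed.

Lemma iter_leq n (g : nat -> nat) a : (forall b, g b <= b) -> iter n g a <= a.
Proof. by move=> h; elim: n => //= n; apply: leq_trans. Qed.

Lemma cmp_add p d f g : cmp p d f -> cmp p d g -> cmp p d (fun M rho => f M rho + g M rho).
Proof.
move: d f g; apply: cmp_op2 => d x y hx hy.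
have e n a : iteri n (fun _ b => b.+1) a = n + a by elim: n => //= n ->.
apply: cmp_ext (@cmp_rec p d (fun _ rho => rho x) (fun _ rho => rho y) (fun _ _ _ a => a.+1)
  (fun _ rho => rho x + rho y) _ _ _ _ _) => //.
- by move=> D hD; apply/cmp_S/cmp_var; lia.
- move=> _; split; first by apply: pbound_add; apply: pbound_var.
  by move=> M rho i hi; rewrite e leq_add2r.
- exact: cmp_var.
- exact: cmp_var.
Qed.

Lemma cmp_sub p d f g : cmp p d f -> cmp p d g -> cmp p d (fun M rho => f M rho - g M rho).
Proof.
move: d f g; apply: cmp_op2 => d x y hx hy.
have e n a : iteri n (fun _ b => b.-1) a = a - n by elim: n => [|n /= ->] /=; lia.
apply: cmp_ext (@cmp_rec p d (fun _ rho => rho y) (fun _ rho => rho x) (fun _ _ _ a => a.-1)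
  (fun _ rho => rho x) _ _ _ _ _) => //.
- by move=> D hD; apply/cmp_pred/cmp_var; lia.
- move=> _; split; first by apply: pbound_var.
  by move=> M rho i hi; rewrite e leq_subr.
- exact: cmp_var.
- exact: cmp_var.
Qed.

Lemma cmp_mul p d f g : cmp p d f -> cmp p d g -> cmp p d (fun M rho => f M rho * g M rho).
Proof.
move: d f g; apply: cmp_op2 => d x y hx hy.
have e n a : iteri n (fun _ b => b + a) 0 = n * a by elim: n => [|n /= ->] //; lia.
apply: cmp_ext (@cmp_rec p d (fun _ rho => rho x) (fun _ _ => 0) (fun _ rho _ a => a + rho y)
  (fun _ rho => rho x * rho y) _ _ _ _ _) => //.
- by move=> _ a M rho rho' h; rewrite h.
- by move=> D hD; apply: cmp_add; apply: cmp_var; lia.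
- move=> _; split; first by apply: pbound_mul; apply: pbound_var.
  by move=> M rho i hi; rewrite e leq_mul2r hi orbT.
- exact: cmp_var.
- exact: cmp_const.
Qed.

Lemma cmp_leq p d f g : cmp p d f -> cmp p d g -> cmp p d (fun M rho => f M rho <= g M rho : nat).
Proof.
move=> cf cg; apply: cmp_ext (cmp_sub (cmp_const _ _ 1) (cmp_sub cf cg)) => M rho.
by rewrite -subn_eq0; case: (_ - g M rho).
Qed.

Lemma cmp_and p d (a b : seq bool -> valuation -> bool) :
  cmp p d (fun M rho => a M rho : nat) -> cmp p d (fun M rho => b M rho : nat) ->
  cmp p d (fun M rho => a M rho && b M rho : nat).
Proof. by move=> ca cb; apply: cmp_ext (cmp_mul ca cb) => M rho; case: (a M rho); case: (b M rho). Qed.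

Lemma cmp_not p d (a : seq bool -> valuation -> bool) :
  cmp p d (fun M rho => a M rho : nat) -> cmp p d (fun M rho => ~~ a M rho : nat).
Proof. by move=> ca; apply: cmp_ext (cmp_sub (cmp_const _ _ 1) ca) => M rho; case: (a M rho). Qed.

Lemma cmp_or p d (a b : seq bool -> valuation -> bool) :
  cmp p d (fun M rho => a M rho : nat) -> cmp p d (fun M rho => b M rho : nat) ->
  cmp p d (fun M rho => a M rho || b M rho : nat).
Proof.
move=> ca cb; apply: cmp_ext (cmp_not (cmp_and (cmp_not ca) (cmp_not cb))) => M rho.
by case: (a M rho); case: (b M rho).
Qed.

Lemma cmp_eq p d f g : cmp p d f -> cmp p d g -> cmp p d (fun M rho => f M rho == g M rho : nat).
Proof.
move=> cf cg; apply: cmp_ext (cmp_and (cmp_leq cf cg) (cmp_leq cg cf)) => M rho.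
by rewrite eqn_leq.
Qed.

Lemma cmp_if p d (b : seq bool -> valuation -> bool) f g :
  cmp p d (fun M rho => b M rho : nat) -> cmp p d f -> cmp p d g ->
  cmp p d (fun M rho => if b M rho then f M rho else g M rho).
Proof.
move=> cb cf cg; apply: cmp_ext (cmp_add (cmp_mul cb cf) (cmp_mul (cmp_not cb) cg)) => M rho.
by case: (b M rho) => /=; lia.
Qed.

Lemma cmp_ifb p d (b f g : seq bool -> valuation -> bool) :
  cmp p d (fun M rho => b M rho : nat) -> cmp p d (fun M rho => f M rho : nat) ->
  cmp p d (fun M rho => g M rho : nat) ->
  cmp p d (fun M rho => (if b M rho then f M rho else g M rho) : nat).
Proof.
by move=> cb cf cg; apply: cmp_ext (cmp_if cb cf cg) => M rho; case: (b M rho).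
Qed.

(** The accumulator grows as long as its next multiple of [y] still fits into [x]. The guard [0 < y]
    reproduces the convention that division by 0 gives 0. *)
Lemma iteri_div x y n : n <= x ->
  iteri n (fun _ a => a + ((0 < y) && (a.+1 * y <= x))) 0 = minn n (x %/ y).
Proof.
case: y => [|y]; first by rewrite divn0 minn0 => _; elim: n => //= n ->.
elim: n => [|n ih] hn; first by rewrite min0n.
have {}ih := ih (ltnW hn); rewrite /= in ih *; rewrite ih -leq_divRL //.
by move: (x %/ y.+1) => q; case: (ltnP (minn n q) q) => h /=; lia.
Qed.

Lemma cmp_div p d f g : cmp p d f -> cmp p d g -> cmp p d (fun M rho => f M rho %/ g M rho).
Proof.
move: d f g; apply: cmp_op2 => d x y hx hy.
apply: cmp_ext (@cmp_rec p d (fun _ rho => rho x) (fun _ _ => 0)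
  (fun _ rho _ a => a + ((0 < rho y) && (a.+1 * rho y <= rho x)))
  (fun _ rho => rho x) _ _ _ _ _) => //.
- by move=> M rho; rewrite iteri_div //; apply/minn_idPr/leq_div.
- by move=> _ a M rho rho' h; rewrite !h.
- move=> D hD; apply: cmp_add; first by apply: cmp_var; lia.
  apply: cmp_and; apply: cmp_leq.
  + exact: cmp_const.
  + by apply: cmp_var; lia.
  + apply: cmp_mul; first apply: cmp_S; by apply: cmp_var; lia.
  + by apply: cmp_var; lia.
- move=> _; split; first exact: pbound_var.
  by move=> M rho i hi; rewrite iteri_div // (leq_trans (geq_minl _ _)).
- exact: cmp_var.
- exact: cmp_const.
Qed.

Lemma cmp_mod p d f g : cmp p d f -> cmp p d g -> cmp p d (fun M rho => f M rho %% g M rho).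
Proof.
move=> cf cg; apply: cmp_ext (cmp_sub cf (cmp_mul (cmp_div cf cg) cg)) => M rho.
by rewrite {1}(divn_eq (f M rho) (g M rho)) addKn.
Qed.

(** Lowest digit first. Repeated division is used because the power [q ^ i] would exceed the
    polynomial bounds, whereas quotients only shrink. *)
Definition digit q i a := iter i (fun x => x %/ q) a %% q.

Lemma cmp_digit p d f g h : cmp p d f -> cmp p d g -> cmp p d h ->
  cmp p d (fun M rho => digit (f M rho) (g M rho) (h M rho)).
Proof.
move=> cf cg ch; apply: cmp_mod => //.
apply: cmp_ext (@cmp_rec p d g h (fun M rho _ a => a %/ f M rho) h _ _ _ _ _) => //.
- by move=> _ a M rho rho' e; rewrite (cf.1 _ _ _ e).
- move=> D hD; apply: cmp_div; first by apply: cmp_var; lia.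
  by apply: cmp_mono cf; lia.
- move=> hp; split; first by have [s [T [_ /(_ hp)[]]]] := ch.2 d (leqnn d).
  move=> M rho i hi; rewrite (iteri_iter i (fun x => x %/ f M rho)).
  by apply: iter_leq => b; apply: leq_div.
Qed.

Lemma cmp_exists p d n (P : seq bool -> valuation -> nat -> bool) :
  (forall v, local d (fun M rho => P M rho v)) ->
  (forall D x, d <= D -> x < D -> cmp p D (fun M rho => P M rho (rho x) : nat)) ->
  cmp p d n -> cmp p d (fun M rho => has (P M rho) (iota 0 (n M rho)) : nat).
Proof.
move=> lP cP cn.
have e m Q : iteri m (fun i a => if Q i then 1 else a) 0 = has Q (iota 0 m).
  elim: m => // m ih; rewrite (_ : iota 0 m.+1 = iota 0 m ++ [:: m]); last by rewrite -addn1 iotaD.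
  rewrite iteriS ih has_cat /= orbF.
  by case: (has _ _); case: (Q _).
apply: cmp_ext (@cmp_rec p d n (fun _ _ => 0) (fun M rho i a => if P M rho i then 1 else a)
  (fun _ _ => 1) _ _ _ _ _) => //.
- by move=> i a M rho rho' h /=; case: (P M rho i) (P M rho' i) (lP i M _ _ h) => -[].
- move=> D hD; apply: cmp_if; [|exact: cmp_const|by apply: cmp_var; lia].
  by apply: cP; lia.
- move=> _; split; first exact: pbound_const.
  by move=> M rho i hi; rewrite e leq_b1.
- exact: cmp_const.
Qed.

Lemma cmp_exp d f g : cmp false d f -> cmp false d g -> cmp false d (fun M rho => f M rho ^ g M rho).
Proof.
move: d f g; apply: cmp_op2 => d x y hx hy.
have e n a : iteri n (fun _ b => b * a) 1 = a ^ n.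
  by elim: n => [|n /= ->] //; rewrite expnSr.
(* Powers are provided only with [p = false], where the condition on the bound is vacuous; the
   function 0 is a placeholder for it. *)
apply: cmp_ext (@cmp_rec false d (fun _ rho => rho y) (fun _ _ => 1) (fun _ rho _ a => a * rho x)
  (fun _ _ => 0) _ _ _ _ _) => //.
- by move=> _ a M rho rho' h; rewrite h.
- by move=> D hD; apply: cmp_mul; apply: cmp_var; lia.
- exact: cmp_var.
- exact: cmp_const.
Qed.

(** * Reading the bit list *)

Lemma updC T (f : nat -> T) i j x y : i != j -> upd (upd f i x) j y = upd (upd f j y) i x.
Proof.
move=> /eqP h; apply: functional_extensionality => z; rewrite /upd.
by case: eqP => // ->; case: eqP => // e; case: h.
Qed.

Lemma regs_upd0 O X Y M rho v : upd (regs O X Y M rho) 0 v = regs v X Y M rho.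
Proof. by apply: functional_extensionality => -[|[|[|[|[|z]]]]]. Qed.
Lemma regs_upd1 O X Y M rho v : upd (regs O X Y M rho) 1 v = regs O v Y M rho.
Proof. by apply: functional_extensionality => -[|[|[|[|[|z]]]]]. Qed.
Lemma regs_upd2 O X Y M rho v : upd (regs O X Y M rho) 2 v = regs O X v M rho.
Proof. by apply: functional_extensionality => -[|[|[|[|[|z]]]]]. Qed.
Lemma regs_upd3 O X Y M rho v : upd (regs O X Y M rho) 3 v = regs O X Y v rho.
Proof. by apply: functional_extensionality => -[|[|[|[|[|z]]]]]. Qed.
Lemma regs_upd4 O X Y M rho : upd (regs O X Y M rho) 4 [::] = regs O X Y M rho.
Proof. by apply: functional_extensionality => -[|[|[|[|[|z]]]]]. Qed.

Definition shift i j := Case i Skip (Push j false) (Push j true).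

Lemma exec_shift i j st : i != j ->
  exec (shift i j) st (if st i is _ :: _ then 2 else 1)
    (if st i is b :: r then upd (upd st i r) j (b :: st j) else st).
Proof.
move=> ne; case E: (st i) => [|b r]; first by apply: XCaseN => //; apply: XSkip.
have e : upd st i r j = st j by rewrite /upd eq_sym (negPf ne).
by apply: XCase E _; rewrite -e; case: b; apply: XPush.
Qed.

Section Get.
Variables (O X Y M : seq bool) (rho : valuation) (D v : nat).

Let w := minn v (size M).
Definition regs4 O X Y M' M2 r := upd (regs O X Y M' r) 4 M2.
Notation st3 := (regs4 O X Y).

Let st3_3 M' M2 r : st3 M' M2 r 3 = M'. Proof. by []. Qed.
Let st3_4 M' M2 r : st3 M' M2 r 4 = M2. Proof. by []. Qed.
Let st3_reg M' M2 r x : st3 M' M2 r (reg x) = nseq (r x) true. Proof. by []. Qed.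
Let st3_upd3 M' M2 r z : upd (st3 M' M2 r) 3 z = st3 z M2 r.
Proof. by rewrite /regs4 updC // regs_upd3. Qed.
Let st3_upd4 M' M2 r z : upd (st3 M' M2 r) 4 z = st3 M' z r.
Proof. by rewrite /regs4 updd. Qed.
Let st3_updr M' M2 r x z : upd (st3 M' M2 r) (reg x) (nseq z true) = st3 M' M2 (upd r x z).
Proof. by rewrite /regs4 updC // regs_upd. Qed.
Let st3_pushr M' M2 r x : upd (st3 M' M2 r) (reg x) (true :: st3 M' M2 r (reg x)) = st3 M' M2 (upd r x (r x).+1).
Proof. by rewrite -st3_updr. Qed.

(** To read bit [v], the bits above it are parked on stack 4 and put back afterwards, [D.+1]
    remembering [v]. Past the end of the list the moves do nothing and [false] is read, as with
    [nth false]. *)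
Definition get_dig := While (reg D) (Seq (Push (reg D.+1) true) (shift 3 4)).
Definition get_fill := While (reg D.+1) (shift 4 3).
Definition get_read := Case 3 Skip (Push 3 false) (Seq (Push 3 true) (Push (reg D) true)).

Lemma exec_dig : rho D = v -> rho D.+1 = 0 ->
  exec get_dig (st3 M [::] rho) ((\sum_(j < v) (1 + (1 + (j < size M))).+1).+1)
    (st3 (drop w M) (rev (take w M)) (upd (upd rho D 0) D.+1 v)).
Proof.
move=> e1 e2.
apply: exec_cast (@exec_while _ _ v (fun j => st3 (drop j M) (rev (take j M)) (upd (upd rho D (v - j)) D.+1 j))
  (fun j => 1 + (1 + (j < size M))) _ _) _ _ _.
- move=> j hj; exists (nseq (v - j.+1) true).
    rewrite st3_reg; have -> : upd (upd rho D (v - j)) D.+1 j D = (v - j.+1).+1 by upd_lia.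
    by [].
  rewrite st3_updr; apply: XSeq; first exact: XPush.
  rewrite st3_pushr; apply: exec_cast (exec_shift _ _) _ _ _; [by []|reflexivity| |].
  + rewrite st3_3; case: (ltnP j (size M)) => h; last by rewrite drop_oversize.
    by rewrite (drop_nth false h).
  + rewrite st3_3 st3_4; case: (ltnP j (size M)) => h.
      rewrite (drop_nth false h) st3_upd3 st3_upd4 (take_nth false h) rev_rcons.
      by congr regs4; ext_upd.
    rewrite drop_oversize // drop_oversize ?take_oversize ?(leqW h) //.
    by congr regs4; ext_upd.
- by rewrite st3_reg (_ : upd _ _ _ _ = 0) //; upd_lia.
- by rewrite drop0 take0; congr regs4; ext_upd.
- by [].
- rewrite subnn /w; case: (leqP v (size M)) => h; first by [].
  by rewrite !drop_oversize ?take_oversize // ltnW.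
Qed.

Lemma exec_read r : r D = 0 ->
  exec get_read (st3 (drop w M) (rev (take w M)) r)
    (if drop w M is b :: _ then (1 + b).+1 else 1)
    (st3 (drop w M) (rev (take w M)) (upd r D (nth false M v))).
Proof.
move=> e1; have e0 : upd r D false = r by rewrite -[RHS](upd_same r D) e1.
have [h|h] := ltnP v (size M); last first.
  have -> : w = size M by apply/minn_idPr.
  rewrite drop_oversize // nth_default //; apply: XCaseN; first by [].
  by rewrite e0; apply: XSkip.
have -> : w = v by apply/minn_idPl/ltnW.
rewrite (drop_nth false h); apply: (@XCase _ _ _ _ _ (nth false M v) (drop v.+1 M)); first by [].
rewrite st3_upd3; case: (nth _ _ _).
  apply: XSeq; first exact: XPush.
  rewrite st3_upd3 st3_3; apply: exec_cast (XPush _ _ _) _ _ _ => //.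
  by rewrite st3_pushr e1.
apply: exec_cast (XPush _ _ _) _ _ _; [reflexivity|reflexivity|].
by rewrite st3_upd3 st3_3 e0.
Qed.

Lemma exec_fill r : r D.+1 = v ->
  exec get_fill (st3 (drop w M) (rev (take w M)) r) ((\sum_(j < v) (1 + (j < w)).+1).+1)
    (st3 M [::] (upd r D.+1 0)).
Proof.
move=> e1; have wv : w <= v by apply: geq_minl.
have wM : w <= size M by apply: geq_minr.
apply: exec_cast (@exec_while _ _ v (fun j => st3 (drop (w - j) M) (rev (take (w - j) M)) (upd r D.+1 (v - j)))
  (fun j => 1 + (j < w)) _ _) _ _ _.
- move=> j hj; exists (nseq (v - j.+1) true).
    rewrite st3_reg updE; have -> : v - j = (v - j.+1).+1 by lia.
    by [].
  rewrite st3_updr updd; apply: exec_cast (exec_shift _ _) _ _ _; [by []|reflexivity| |].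
  + rewrite st3_4; case: (ltnP j w) => h; last first.
      by rewrite (_ : w - j = 0) ?take0 //; lia.
    have h' : w - j.+1 < size M by lia.
    have -> : w - j = (w - j.+1).+1 by lia.
    by rewrite (take_nth false h') rev_rcons.
  + rewrite st3_4 st3_3; case: (ltnP j w) => h; last first.
      have -> : w - j = 0 by lia.
      have -> : w - j.+1 = 0 by lia.
      by rewrite take0.
    have h' : w - j.+1 < size M by lia.
    have -> : w - j = (w - j.+1).+1 by lia.
    by rewrite (take_nth false h') rev_rcons st3_upd4 st3_upd3 -(drop_nth false h').
- by rewrite st3_reg updE subnn.
- by rewrite !subn0 -e1 upd_same.
- by [].
- have -> : w - v = 0 by lia.
  by rewrite drop0 take0 subnn.
Qed.

Lemma exec_get : rho D = v -> rho D.+1 = 0 ->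
  exec (Seq get_dig (Seq get_read get_fill)) (regs O X Y M rho)
    ((\sum_(j < v) (1 + (1 + (j < size M))).+1).+1 +
     ((if drop w M is b :: _ then (1 + b).+1 else 1) + (\sum_(j < v) (1 + (j < w)).+1).+1))
    (regs O X Y M (upd rho D (nth false M v))).
Proof.
move=> e1 e2; rewrite -regs_upd4; apply: XSeq; first exact: exec_dig.
apply: XSeq; first by apply: exec_read; upd_lia.
apply: exec_cast (@exec_fill (upd (upd (upd rho D 0) D.+1 v) D (nth false M v)) _) _ _ _; [by upd_lia|reflexivity|reflexivity|].
by rewrite /regs4 regs_upd4; congr regs; ext_upd.
Qed.

End Get.

Lemma cmp_get p d f : cmp p d f -> cmp p d (fun M rho => nth false M (f M rho) : nat).
Proof.
move=> [lf cf]; split=> [M rho rho' h|D hD]; first by rewrite (lf M _ _ h).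
have [s [T [h1 h2]]] := cf D hD.
exists (Seq s (Seq (get_dig D) (Seq (get_read D) (get_fill D)))).
exists (fun M rho => T M rho + ((\sum_(j < f M rho) (1 + (1 + (j < size M))).+1).+1 +
     ((if drop (minn (f M rho) (size M)) M is b :: _ then (1 + b).+1 else 1) +
      (\sum_(j < f M rho) (1 + (j < minn (f M rho) (size M))).+1).+1))).
split.
  move=> O X Y M rho z; apply: XSeq (h1 O X Y M rho z) _.
  apply: exec_cast (@exec_get O X Y M (upd rho D (f M rho)) D (f M rho) _ _) _ _ _;
    [by rewrite updE| |reflexivity|reflexivity|by rewrite updd].
  by have := z D.+1 (leqnSn D); upd_lia.
move=> /h2[b1 b2]; split; last first.
  by apply: pbound_le (pbound_const D 1) => M rho; rewrite leq_b1.
apply: pbound_add => //.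
apply: (@pbound_le _ _ (fun M rho => 4 * f M rho + 1 + (3 + (3 * f M rho + 1)))).
  move=> M rho; apply: leq_add; last apply: leq_add.
  - rewrite addn1 ltnS mulnC -[X in X * 4]card_ord -sum_nat_const.
    by apply: leq_sum => j _; case: (j < size M).
  - by case: (drop _ _) => [|[] ?].
  - rewrite addn1 ltnS mulnC -[X in X * 3]card_ord -sum_nat_const.
    by apply: leq_sum => j _; case: (j < minn _ _).
by repeat first [apply: pbound_add|apply: pbound_mul|apply: pbound_const|exact: b2].
Qed.

(** * Counting the steps of a program *)

Fixpoint counting N (s : stmt) : stmt :=
  match s with
  | Skip => Skip
  | Push i b => Seq (Push i b) (Push N true)
  | Seq a b => Seq (counting N a) (counting N b)
  | Case i a b c => Seq (Push N true) (Case i (counting N a) (counting N b) (counting N c))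
  | While i a => Seq (While i (Seq (Push N true) (counting N a))) (Push N true)
  end.

(** Stack [N] is untouched by [s], so ticks commute with its instructions. A loop ticks inside for
    each successful test and once after it for the failing one; the initial count [u] is general for
    the induction. *)
Lemma exec_counting N s st t st' : exec s st t st' -> below N s -> forall u,
  exists t', exec (counting N s) (upd st N (nseq u true)) t' (upd st' N (nseq (u + t) true)).
Proof.
have tick st0 u : exec (Push N true) (upd st0 N (nseq u true)) 1 (upd st0 N (nseq u.+1 true)).
  by apply: exec_cast (XPush _ _ _) _ _ _ => //; rewrite updE updd.
have get st0 i u : i < N -> upd st0 N (nseq u true) i = st0 i by upd_lia.
have ne i : i < N -> i != N by move/ltn_eqF ->.
have ne' i : i < N -> N != i by move/ltn_eqF; rewrite eq_sym => ->.
move=> h; elim: h => {s st t st'} /=.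
- by move=> s _ u; exists 0; rewrite addn0; apply: XSkip.
- move=> i b s hi u; exists (1 + 1); apply: XSeq; first exact: XPush.
  by rewrite get // updC ?ne' // addn1; apply: tick.
- move=> a b s t s' t' s'' _ iha _ ihb /andP[ha hb] u.
  have [t1 h1] := iha ha u; have [t2 h2] := ihb hb (u + t).
  by exists (t1 + t2); rewrite addnA; apply: XSeq h1 h2.
- move=> i a b c s t s' hs _ ih /and4P[hi ha hb hc] u.
  have [t1 h1] := ih ha u.+1.
  exists (1 + t1.+1); apply: XSeq (tick _ _) _; rewrite addnS -addSn.
  by apply: XCaseN h1; rewrite get.
- move=> i a b c s v r t s' hs _ ih /and4P[hi ha hb hc] u.
  have hbc : below N (if v then c else b) by case: (v).
  have [t1 h1] := ih hbc u.+1.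
  exists (1 + t1.+1); apply: XSeq (tick _ _) _; rewrite addnS -addSn.
  apply: (@XCase _ _ _ _ _ v r); first by rewrite get.
  by rewrite updC ?ne' //; case: (v) h1.
- move=> i a s hs /andP[hi ha] u; exists (1 + 1); rewrite [u + 1]addn1.
  by apply: XSeq (tick _ _); apply: XWhileN; rewrite get.
- move=> i a s r hs /andP[hi ha] u; exists (1 + 1); rewrite [u + 1]addn1.
  apply: XSeq (tick _ _); rewrite (updC s) ?ne //.
  by apply: XWhileF; rewrite get.
- move=> i a s r t s' t' s'' hs _ iha _ ihw /andP[hi ha] u.
  have [t1 h1] := iha ha u.+1.
  have [|t2 h2] := ihw _ (u.+1 + t); first by rewrite hi.
  (* The induction hypothesis covers the remaining loop together with its final tick; the tick is
     split off so that the current round can be put in front of the loop proper. *)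
  inversion h2 as [| |a' b' s1 t3 s2 t4 s3 h3 h4| | | | |]; subst.
  exists ((1 + t1 + t3).+1 + t4); apply: (@XSeq _ _ _ _ s2).
    apply: (@XWhileT _ _ _ r); first by rewrite get.
      apply: XSeq; last exact: h1.
      by rewrite updC ?ne' //; apply: tick.
    exact: h3.
  by rewrite addnS -addSn addnA.
Qed.

(** * Programs that print a graph *)

Definition parse r := While 0 (Push (reg r) true).

Lemma exec_parse r v O X Y M rho :
  exec (parse r) (regs (enc_nat v ++ O) X Y M rho) (2 * v).+1
    (regs O X Y M (upd rho r (rho r + v))).
Proof.
elim: v rho => [|v ih] rho.
  rewrite addn0 upd_same -(regs_upd0 (enc_nat 0 ++ O) X Y M rho O).
  exact: XWhileF.
rewrite mulnS -[(2 + 2 * v).+1]/(1 + (2 * v).+1).+1.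
apply: (@XWhileT _ _ _ (enc_nat v ++ O)) => //.
  by rewrite regs_upd0; apply: exec_push.
by apply: exec_cast (ih _) _ _ _; [reflexivity|reflexivity|rewrite updE updd addSnnS].
Qed.

Lemma exec_reg_to_1 r O X Y M rho :
  exec (While (reg r) (Push 1 true)) (regs O X Y M rho) (2 * rho r).+1
    (regs O (nseq (rho r) true ++ X) Y M (upd rho r 0)).
Proof.
apply: exec_cast (@exec_while _ _ (rho r)
  (fun j => regs O (nseq j true ++ X) Y M (upd rho r (rho r - j))) (fun _ => 1) _ _) _ _ _.
- move=> j hj; exists (nseq (rho r - j.+1) true).
    by rewrite [LHS]/= updE (_ : rho r - j = (rho r - j.+1).+1) //; lia.
  rewrite regs_upd updd.
  by apply: exec_cast (XPush _ _ _) _ _ _; [reflexivity|reflexivity|rewrite regs_upd1].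
- by rewrite /= updE subnn.
- by rewrite subn0 upd_same.
- by rewrite sum_nat_const card_ord mulnC.
- by rewrite subnn.
Qed.

Lemma exec_1_to_reg r v O Y M rho :
  exec (While 1 (Push (reg r) true)) (regs O (nseq v true) Y M rho) (2 * v).+1
    (regs O [::] Y M (upd rho r (rho r + v))).
Proof.
apply: exec_cast (@exec_while _ _ v
  (fun j => regs O (nseq (v - j) true) Y M (upd rho r (rho r + j))) (fun _ => 1) _ _) _ _ _.
- move=> j hj; exists (nseq (v - j.+1) true).
    by rewrite [LHS]/= (_ : v - j = (v - j.+1).+1) //; lia.
  rewrite regs_upd1; apply: exec_cast (exec_push _ _ _ _ _ _) _ _ _ => //.
  by rewrite updE updd addnS.
- by rewrite /= subnn.
- by rewrite subn0 addn0 upd_same.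
- by rewrite sum_nat_const card_ord mulnC.
- by rewrite subnn.
Qed.

Lemma exec_reg_to_0 r O X Y M rho :
  exec (While (reg r) (Push 0 true)) (regs O X Y M rho) (2 * rho r).+1
    (regs (nseq (rho r) true ++ O) X Y M (upd rho r 0)).
Proof.
apply: exec_cast (@exec_while _ _ (rho r)
  (fun j => regs (nseq j true ++ O) X Y M (upd rho r (rho r - j))) (fun _ => 1) _ _) _ _ _.
- move=> j hj; exists (nseq (rho r - j.+1) true).
    by rewrite [LHS]/= updE (_ : rho r - j = (rho r - j.+1).+1) //; lia.
  rewrite regs_upd updd.
  by apply: exec_cast (XPush _ _ _) _ _ _; [reflexivity|reflexivity|rewrite regs_upd0].
- by rewrite /= updE subnn.
- by rewrite subn0 upd_same.
- by rewrite sum_nat_const card_ord mulnC.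
- by rewrite subnn.
Qed.

Lemma exec_0_to_2 r bits O X Y M rho : rho r = size bits ->
  exec (While (reg r) (shift 0 2)) (regs (bits ++ O) X Y M rho) (3 * size bits).+1
    (regs O X (rev bits ++ Y) M (upd rho r 0)).
Proof.
move=> e; apply: exec_cast (@exec_while _ _ (size bits)
  (fun j => regs (drop j bits ++ O) X (rev (take j bits) ++ Y) M (upd rho r (size bits - j)))
  (fun _ => 2) _ _) _ _ _.
- move=> j hj; exists (nseq (size bits - j.+1) true).
    by rewrite [LHS]/= updE (_ : size bits - j = (size bits - j.+1).+1) //; lia.
  rewrite regs_upd updd (drop_nth false hj) (take_nth false hj) rev_rcons.
  apply: exec_cast (exec_shift _ _) _ _ _; [by []|reflexivity|by []|].
  by rewrite [LHS]/= regs_upd0 regs_upd2.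
- by rewrite /= updE subnn.
- by rewrite drop0 take0 subn0 -e upd_same.
- by rewrite sum_nat_const card_ord mulnC.
- by rewrite drop_size take_size subnn.
Qed.

Lemma exec_2_to_3 r bits O X M rho : rho r = size bits ->
  exec (While (reg r) (shift 2 3)) (regs O X bits M rho) (3 * size bits).+1
    (regs O X [::] (rev bits ++ M) (upd rho r 0)).
Proof.
move=> e; apply: exec_cast (@exec_while _ _ (size bits)
  (fun j => regs O X (drop j bits) (rev (take j bits) ++ M) (upd rho r (size bits - j)))
  (fun _ => 2) _ _) _ _ _.
- move=> j hj; exists (nseq (size bits - j.+1) true).
    by rewrite [LHS]/= updE (_ : size bits - j = (size bits - j.+1).+1) //; lia.
  rewrite regs_upd updd (drop_nth false hj) (take_nth false hj) rev_rcons.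
  apply: exec_cast (exec_shift _ _) _ _ _; [by []|reflexivity|by []|].
  by rewrite [LHS]/= regs_upd2 regs_upd3.
- by rewrite /= updE subnn.
- by rewrite drop0 take0 subn0 -e upd_same.
- by rewrite sum_nat_const card_ord mulnC.
- by rewrite drop_size take_size subnn.
Qed.

(** Each constant may use the earlier ones. The bit list is empty here, so that values and running
    time depend on k and c alone. *)
Fixpoint consts d (fs : seq fn) (rho : valuation) : valuation :=
  if fs is f :: fs' then consts d.+1 fs' (upd rho d (f [::] rho)) else rho.

Fixpoint consts_ok d (fs : seq fn) : Prop :=
  if fs is f :: fs' then cmp false d f /\ consts_ok d.+1 fs' else True.

Lemma consts_below d fs rho x : x < d -> consts d fs rho x = rho x.
Proof. by elim: fs d rho => //= f fs ih d rho hx; rewrite ih; [upd_lia|lia]. Qed.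

Lemma consts_above d fs rho x : d + size fs <= x -> (forall y, d <= y -> rho y = 0) ->
  consts d fs rho x = 0.
Proof.
elim: fs d rho => /= [|f fs ih] d rho hx h0; first by apply: h0; lia.
by apply: ih => [|y hy]; [lia|rewrite /upd; case: eqP => [?|_]; [lia|apply: h0; lia]].
Qed.

Lemma exec_consts d fs : consts_ok d fs -> exists s T, forall O X Y rho,
  (forall y, d <= y -> rho y = 0) ->
  exec s (regs O X Y [::] rho) (T rho) (regs O X Y [::] (consts d fs rho)).
Proof.
elim: fs d => [|f fs ih] d /=; first by exists Skip, (fun _ => 0) => O X Y rho _; apply: XSkip.
case=> cf /ih [s [T h]]; have [s' [T' [h' _]]] := cf.2 d (leqnn d).
exists (Seq s' s), (fun rho => T' [::] rho + T (upd rho d (f [::] rho))) => O X Y rho h0.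
apply: XSeq (h' _ _ _ _ _ h0) _; apply: h => y hy.
by rewrite /upd; case: eqP => [?|_]; [lia|apply: h0; lia].
Qed.

Section Output.
Variables (D : nat) (adj : seq bool -> valuation -> bool) (s : stmt) (T : fn).
Hypothesis comp_adj : computes D.+1 s (fun M rho => adj M rho : nat) T.

(** The index counts down because output is pushed on a stack and so appears last bit first. The
    [Case] both reads the result register and empties it for the next round. *)
Definition print_bits :=
  While (reg D) (Seq s (Case (reg D.+1) (Push 0 false) Skip (Push 0 true))).

Lemma exec_print_bits O X Y M rho : (forall y, D < y -> rho y = 0) ->
  exec print_bits (regs O X Y M rho)
    (\sum_(j < rho D) (T M (upd rho D (rho D - j.+1)) + 2).+1).+1
    (regs ([seq adj M (upd rho D v) | v <- iota 0 (rho D)] ++ O) X Y M (upd rho D 0)).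
Proof.
move=> h0; set n := rho D.
apply: exec_cast (@exec_while _ _ n
  (fun j => regs ([seq adj M (upd rho D v) | v <- iota (n - j) j] ++ O) X Y M (upd rho D (n - j)))
  (fun j => T M (upd rho D (n - j.+1)) + 2) _ _) _ _ _.
- move=> j hj; exists (nseq (n - j.+1) true).
    by rewrite [LHS]/= updE (_ : n - j = (n - j.+1).+1) //; lia.
  rewrite regs_upd updd; apply: XSeq.
    by apply: comp_adj => y hy; rewrite /upd; case: eqP => [?|_]; [lia|apply: h0].
  have -> : n - j = (n - j.+1).+1 by lia.
  set rh := upd rho D (n - j.+1).
  have z1 : rh D.+1 = 0 by rewrite /rh; have := h0 D.+1 (leqnn _); upd_lia.
  have e : upd rh D.+1 0 = rh by rewrite -z1 upd_same.
  rewrite (_ : [seq adj M (upd rho D v) | v <- iota (n - j.+1) j.+1] =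
    adj M rh :: [seq adj M (upd rho D v) | v <- iota (n - j.+1).+1 j]) //.
  case E: (adj M rh).
    apply: (@XCase _ _ _ _ _ true [::]); first by rewrite /= updE.
    rewrite -[[::]]/(nseq 0 true) regs_upd updd e.
    by apply: exec_cast (XPush _ _ _) _ _ _; [reflexivity|reflexivity|rewrite regs_upd0].
  apply: XCaseN; first by rewrite /= updE.
  rewrite [nat_of_bool _]/= e.
  by apply: exec_cast (XPush _ _ _) _ _ _; [reflexivity|reflexivity|rewrite regs_upd0].
- by rewrite /= updE subnn.
- by rewrite subn0 upd_same.
- by [].
- by rewrite subnn.
Qed.

End Output.

Lemma cmp_sumregs p d D : D <= d -> cmp p d (fun _ rho => \sum_(x < D) rho x).
Proof.
elim: D => [|D ih] h.
  by apply: cmp_ext (cmp_const _ _ 0) => M rho; rewrite big_ord0.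
apply: cmp_ext (cmp_add (ih (ltnW h)) (cmp_var _ h)) => M rho.
by rewrite big_ord_recr.
Qed.

Definition params k c : valuation := upd (upd (fun _ => 0) 0 k) 1 c.

Lemma params0 k c y : 2 <= y -> params k c y = 0.
Proof. by rewrite /params; upd_lia. Qed.

Lemma input_state_regs x : input_state x = regs x [::] [::] [::] (fun _ => 0).
Proof. by apply: functional_extensionality => -[|[|[|[|[|z]]]]]. Qed.

(* The price of the constants is measured by a copy of the program computing them
   that counts its own steps. *)
Lemma computable_cost fs s T a : consts_ok 2 fs ->
  (forall O X Y rho, (forall y, 2 <= y -> rho y = 0) ->
    exec s (regs O X Y [::] rho) (T rho) (regs O X Y [::] (consts 2 fs rho))) ->
  computable2 (fun k c =>
    (\sum_(x < 2 + size fs) consts 2 fs (params k c) x + T (params k c) + 2) ^ a).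
Proof.
move=> ok hs; set D := 2 + size fs.
have [N' hN'] := ex_below s; pose x1 := D.+1 + N'.
have hN : below (reg x1) s by apply: below_leq hN'; rewrite /x1; lia.
have cF : cmp false D.+1 (fun _ rho => (\sum_(x < D.+1) rho x + 2) ^ a).
  apply: cmp_exp; last exact: cmp_const.
  by apply: cmp_add; [apply: cmp_sumregs|apply: cmp_const].
have [sF [TF [hF _]]] := cF.2 D.+1 (leqnn _).
have [Mf [A hM]] := stmt_machine (Seq (parse 0) (Seq (parse 1) (Seq (counting (reg x1) s)
  (Seq (move_reg x1 D) (Seq sF (While (reg D.+1) (Push 0 true))))))).
exists Mf => k c.
set rS := consts 2 fs (params k c).
have rS0 y : D <= y -> rS y = 0 by move=> hy; apply: consts_above => // z; apply: params0.
pose rh := upd rS D (T (params k c)).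
have [tc hc] := exec_counting (hs [::] [::] [::] _ (params0 k c)) hN 0.
have eF : \sum_(x < D.+1) rh x = \sum_(x < D) rS x + T (params k c).
  rewrite big_ord_recr /= /rh updE; congr (_ + _); apply: eq_bigr => x _.
  by rewrite /upd ltn_eqF.
have H : exists t st, exec (Seq (parse 0) (Seq (parse 1) (Seq (counting (reg x1) s)
    (Seq (move_reg x1 D) (Seq sF (While (reg D.+1) (Push 0 true)))))))
    (input_state (enc_nat k ++ enc_nat c)) t st /\
    st 0 = nseq ((\sum_(x < D) rS x + T (params k c) + 2) ^ a) true.
  eexists; eexists; split.
    rewrite input_state_regs; apply: XSeq; first exact: exec_parse.
    apply: XSeq; first by rewrite -[enc_nat c]cats0; apply: exec_parse.
    apply: XSeq.
      apply: exec_cast hc _ _ _; [|reflexivity|reflexivity].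
      by rewrite regs_upd; congr regs; rewrite /params /x1; ext_upd.
    rewrite regs_upd; apply: XSeq; first by apply: exec_move; rewrite /x1; lia.
    apply: XSeq.
      apply: exec_cast (hF [::] [::] [::] [::] rh _) _ _ _; [| |reflexivity|reflexivity].
        by move=> y hy; rewrite /rh /upd; case: eqP => [?|_]; [lia|apply: rS0; lia].
      have r1 : rS x1 = 0 by apply: rS0; rewrite /x1; lia.
      have r2 := rS0 D (leqnn _).
      congr regs; rewrite /rh -/rS updE; ext_upd.
    exact: exec_reg_to_0.
  by rewrite /= updE cats0 eF.
have [t [st [h1 h2]]] := H.
by eexists; rewrite -h2; apply: hM h1.
Qed.

Lemma pbound_at D F : pbound D F -> exists a, forall M rho V, (forall x, x < D -> rho x <= V) ->
  forall E, a <= E -> F M rho <= (V + 2) ^ E.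
Proof.
move=> [a ha]; exists a => M rho V hV E le; apply: leq_trans (ha M _ _ hV) _.
exact: pow_ge2.
Qed.

Section PrintingMachine.
Variables (fs : seq fn) (fN : fn) (adj : seq bool -> valuation -> bool).
Let D := 2 + size fs.
Hypotheses (ok : consts_ok 2 fs) (cN : cmp true D.+1 fN)
  (cadj : cmp true D.+3 (fun M rho => adj M rho : nat)).

(** Only the constants may be expensive. All other stages are polynomial, with a fixed exponent, in
    n, the constants and their cost. *)
Theorem printing_machine : exists (M : TM) (a : nat) (f : nat -> nat -> nat),
  computable2 f /\ forall n bits k c, size bits = n * n ->
  let rho := upd (consts 2 fs (params k c)) D n in
  let N := fN bits rho in
  outputs_within M (enc_nat n ++ bits ++ enc_nat k ++ enc_nat c) (f k c * n.+1 ^ a)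
    (enc_nat N ++ [seq adj bits (upd (upd rho D.+1 N) D.+2 v) | v <- iota 0 (N * N)]).
Proof.
have [s1 [T1 h1]] := exec_consts ok.
have sq p d x : x < d -> cmp p d (fun _ rho => rho x * rho x).
  by move=> hx; apply: cmp_mul; apply: cmp_var.
have [sn [Tn [hn /(_ isT)[/pbound_at[a1 bn] _]]]] := (sq true 1 0 isT).2 1 (leqnn _).
have [sm [Tm [hm /(_ isT)[/pbound_at[a2 bm] _]]]] := (sq true D.+1 D (leqnn _)).2 D.+1 (leqnn _).
have [sN [TN [hN /(_ isT)[/pbound_at[a3 bN] /pbound_at[aN bfN]]]]] := cN.2 D.+1 (leqnn _).
have [sQ [TQ [hQ /(_ isT)[/pbound_at[a4 bQ] _]]]] := (sq true D.+2 D.+1 (leqnn _)).2 D.+2 (leqnn _).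
have [sA [TA [hA /(_ isT)[/pbound_at[a5 bA] _]]]] := cadj.2 D.+3 (leqnn _).
(* While the constants are computed, n waits on stack 1 and the bits on stack 2. The two moves of
   the bits, to stack 2 and then to stack 3, reverse them twice. The output grows backwards: bits,
   terminator, then the unary vertex count. *)
pose prog := Seq (parse 0) (Seq sn (Seq (While (reg 1) (shift 0 2))
  (Seq (While (reg 0) (Push 1 true)) (Seq (parse 0) (Seq (parse 1) (Seq s1
  (Seq (While 1 (Push (reg D) true)) (Seq sm (Seq (While (reg D.+1) (shift 2 3))
  (Seq sN (Seq sQ (Seq (print_bits D.+2 sA) (Seq (Push 0 false)
  (While (reg D.+1) (Push 0 true))))))))))))))).
have [M [A hM]] := stmt_machine prog.
pose e := 2 * aN + 2; pose E := a1 + a2 + a3 + a4 + a5 + 1.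
pose a := e.+2 * E * (A + 16).
exists M, a, (fun k c => (\sum_(x < D) consts 2 fs (params k c) x + T1 (params k c) + 2) ^ a).
split; first exact: (computable_cost a ok h1).
move=> n bits k c hb rho N.
set rS := consts 2 fs (params k c) in rho N *.
have rS0 y : D <= y -> rS y = 0 by move=> hy; apply: consts_above => // z; apply: params0.
have rho0 y : D < y -> rho y = 0.
  by move=> hy; rewrite /rho /upd; case: eqP => [?|_]; [lia|apply: rS0; lia].
pose r0 : valuation := upd (fun _ => 0) 0 n.
pose rN := upd rho D.+1 N.
pose t := (2 * n).+1 + (Tn [::] r0 + ((3 * size bits).+1 + ((2 * n).+1 + ((2 * k).+1 + ((2 * c).+1 +
  (T1 (params k c) + ((2 * n).+1 + (Tm [::] rho + ((3 * size bits).+1 + (TN bits rho + (TQ bits rN +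
  ((\sum_(j < N * N) (TA bits (upd rN D.+2 (N * N - j.+1)) + 2).+1).+1 + (1 + (2 * N).+1))))))))))))).
pose x := enc_nat n ++ bits ++ enc_nat k ++ enc_nat c.
have hexec : exists st, exec prog (input_state x) t st /\
   st 0 = enc_nat N ++ [seq adj bits (upd rN D.+2 v) | v <- iota 0 (N * N)].
  eexists; split.
    rewrite input_state_regs; apply: XSeq; first exact: exec_parse.
    rewrite -/r0; apply: XSeq.
      by apply: hn => -[].
    apply: XSeq.
      by apply: exec_0_to_2; rewrite updE hb /r0 updE.
    apply: XSeq.
      apply: exec_cast (exec_reg_to_1 _ _ _ _ _ _) _ _ _; [reflexivity| |reflexivity].
      by rewrite /r0; upd_lia.
    apply: XSeq; first exact: exec_parse.
    apply: XSeq; first by rewrite -[enc_nat c]cats0; apply: exec_parse.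
    apply: XSeq.
      apply: exec_cast (h1 [::] (nseq n true) (rev bits) (params k c) (@params0 k c)) _ _ _;
        [|reflexivity|reflexivity].
      by rewrite !cats0; congr regs; rewrite /params /r0; ext_upd.
    apply: XSeq; first exact: exec_1_to_reg.
    rewrite -/rS rS0 // add0n -/rho.
    apply: XSeq; first exact: hm.
    apply: XSeq.
      apply: exec_cast (@exec_2_to_3 D.+1 (rev bits) [::] [::] [::] _ _) _ _ _;
       [|reflexivity|by rewrite size_rev|reflexivity].
      by rewrite updE size_rev hb /rho updE.
    rewrite revK cats0 updd (_ : upd rho D.+1 0 = rho); last first.
      by rewrite -(rho0 D.+1 (leqnn _)) upd_same.
    apply: XSeq; first exact: hN.
    rewrite -/N -/rN; apply: XSeq.
      by apply: hQ => y hy; rewrite /rN /upd; case: eqP => [?|_]; [lia|apply: rho0; lia].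
    apply: XSeq.
      apply: exec_cast (@exec_print_bits D.+2 adj sA TA hA [::] [::] [::] bits
        (upd rN D.+2 (N * N)) _) _ _ _.
      - move=> y hy; rewrite /rN /upd; do 2 (case: eqP => [?|_]; first by lia).
        by apply: rho0; lia.
      - by congr regs; congr upd; rewrite /rN updE.
      - rewrite updE; congr _.+1; apply: eq_bigr => j _; by rewrite updd.
      - reflexivity.
    rewrite updE; apply: XSeq; first exact: XPush.
    rewrite regs_upd0.
    apply: exec_cast (exec_reg_to_0 _ _ _ _ _ _) _ _ _; [reflexivity| |reflexivity].
    by rewrite /rN; upd_lia.
  rewrite [LHS]/= /enc_nat -catA /= cats0; congr (nseq _ _ ++ _ :: _).
    by rewrite /rN; upd_lia.
  by apply: eq_map => v; rewrite updd.
have [st [e1 e2]] := hexec; rewrite -e2.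
apply: outputs_within_leq (hM _ _ _ e1).
(* [V] dominates all register contents, including [N * N] and [n * n]; [X] dominates the cost of
   every computed stage. *)
set Z := _ + T1 _; pose B := Z + n; pose V := (B + 2) ^ e; pose X := (V + 2) ^ E.
have BV : B + 2 <= V by have := pow_ge2 B (_ : 1 <= e); rewrite expn1; apply; rewrite /e; lia.
have rSB y : y < D -> rS y <= \sum_(i < D) rS i.
  by move=> hy; rewrite (bigD1 (Ordinal hy)) //= leq_addr.
have rhoB y : y < D.+1 -> rho y <= B.
  move=> hy; rewrite /rho /upd /B /Z; case: eqP => [_|?]; first exact: leq_addl.
  by have := rSB y; rewrite -/rS; lia.
have rhoV y : y < D.+1 -> rho y <= V by move/rhoB; lia.
have NV : N <= (B + 2) ^ aN by apply: bfN.
have NNV : N * N <= V.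
  by apply: leq_trans (leq_mul NV NV) _; rewrite -expnD /V pow_ge2 // /e; lia.
have NV' : N <= V by apply: leq_trans NNV; case: (N) => // u; apply: leq_pmull.
have nnV : n * n <= V.
  apply: (@leq_trans ((B + 2) ^ 2)); last by rewrite /V pow_ge2 // /e; lia.
  by rewrite expnS expn1; apply: leq_mul; rewrite /B; lia.
have VX : V + 2 <= X by have := pow_ge2 V (_ : 1 <= E); rewrite expn1; apply; rewrite /E; lia.
have r_k : rS 0 = k by rewrite /rS consts_below // /params; upd_lia.
have r_c : rS 1 = c by rewrite /rS consts_below // /params; upd_lia.
have kV : k <= V by move: (rSB 0 isT) BV; rewrite r_k /B /Z; lia.
have cV : c <= V by move: (rSB 1 isT) BV; rewrite r_c /B /Z; lia.
have TV : T1 (params k c) <= V by move: BV; rewrite /B /Z; lia.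
have nV : n <= V by move: BV; rewrite /B; lia.
have q1 : Tn [::] r0 <= X.
  by apply: bn; [case=> // _; rewrite /r0 updE|rewrite /E; lia].
have q2 : Tm [::] rho <= X by apply: bm => //; rewrite /E; lia.
have q3 : TN bits rho <= X by apply: bN => //; rewrite /E; lia.
have rNV y : y < D.+2 -> rN y <= V.
  by move=> hy; rewrite /rN /upd; case: eqP => // ?; apply: rhoV; lia.
have q4 : TQ bits rN <= X by apply: bQ => //; rewrite /E; lia.
have q5 : \sum_(j < N * N) (TA bits (upd rN D.+2 (N * N - j.+1)) + 2).+1 <= X * (X + 3).
  apply: (@leq_trans (\sum_(j < N * N) (X + 3))).
    apply: leq_sum => j _; rewrite -addnS leq_add2r; apply: bA; last by rewrite /E; lia.
    move=> y hy; rewrite {1}/upd; case: eqP => [_|?]; first by apply: leq_trans (leq_subr _ _) NNV.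
    by apply: rNV; lia.
  by rewrite sum_nat_const card_ord leq_mul2r; apply/orP; right; lia.
have q6 : (size x + t).+1 <= 64 * (X * X).
  have -> : size x = n.+1 + (n * n + (k.+1 + c.+1)).
    by rewrite /x /enc_nat !size_cat !size_nseq /= hb !addn1.
  have XX : 2 * X <= X * X by rewrite leq_mul2r; apply/orP; right; lia.
  move: q5; rewrite /t hb mulnDr.
  set Y := X * X in XX *; set S := \sum_(_ < _) _; lia.
(* [A] is below [2 ^ A], and 64 = [2 ^ 6] turns the squared factor into at most [(X ^ 8) ^ 2]. *)
have q7 : A * (size x + t).+1 ^ 2 <= X ^ (A + 16).
  apply: (@leq_trans (2 ^ A * (64 * (X * X)) ^ 2)).
    by apply: leq_mul; [apply/ltnW/ltn_expl|rewrite leq_exp2r].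
  rewrite expnD; apply: leq_mul; first by case: (A) => // u; rewrite leq_exp2r; lia.
  rewrite (expnM X 8 2) leq_exp2r // (expnD X 6 2) -mulnn leq_mul2r -[64]/(2 ^ 6) leq_exp2r //.
  by apply/orP; right; lia.
(* The inequality B + 2 <= (Z + 2)(n + 1) separates the factor in k and c from the power of n +
   1. *)
apply: leq_trans q7 _; rewrite -expnMn /a expnM.
case EA: (A + 16) => [|u]; first by lia.
rewrite leq_exp2r //; apply: leq_trans (pow_comp _ _ _) _.
have -> : e.+2 * E = (e.+2 * E).-1.+1 by rewrite prednK // muln_gt0 /E; lia.
by rewrite leq_exp2r // /B; nia.
Qed.

End PrintingMachine.

(** * The reduction *)

(** Multiplicative hashing: the residues modulo [q * R] are cut into [q] intervals of length [R],
    and the value is the interval containing [p * w]. The modulus need not be prime. *)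
Definition hash q R p w := (p * w) %% (q * R) %/ R.

(* Set [(e, w)] answers the challenge [u], which names a colour pair [e'], one of its
   two coordinates [i'] and a hash value [t]: either [e] is [e'] and the coordinate hashes
   to [t], or [e] is the diagonal colour of [i'] and its vertex does not hash to [t]. *)
Definition answers k q n p u e w :=
  let R := (n * n).+1 in
  let t := u %% q in
  let g := u %/ q in
  let e' := g %/ 2 in
  let i' := if g %% 2 == 0 then e' %/ k else e' %% k in
  (e == e') && (hash q R p (if g %% 2 == 0 then w %/ n else w %% n) == t) ||
  (e == i' * k + i') && ~~ (hash q R p (w %/ n) == t).

(** A colour (i, j) is coded as i k + j and a pair (x, y) as x n + y, which is also its position in
    the adjacency bits. A diagonal colour admits every pair and uses its first coordinate only. *)
Definition admissible (M : seq bool) k e w := (e %/ k == e %% k) || nth false M w.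

(* A base vertex [s] encodes a colour [e < k ^ 2] and a candidate [w < n ^ 2] for that
   colour. An element [z] encodes [(b, p, F)] in mixed radix, where [F < U ^ A] lists in
   base [U] one challenge per tuple [a < A = q ^ (k ^ 2)] of hash values, itself listed
   in base [q]; [b] does not influence adjacency. *)
Definition incident (M : seq bool) k q A U Phi n s z :=
  let R := (n * n).+1 in
  let e := s %/ (n * n) in
  let w := s %% (n * n) in
  let F := z %% Phi in
  let p := z %/ Phi %% (q * R) in
  admissible M k e w &&
  has (fun a => (digit q e a == hash q R p w) && answers k q n p (digit U a F) e w) (iota 0 A).

Definition nsets K n := K * (n * n).
Definition nelts H q Phi n := H * (q * (n * n).+1 * Phi).
Definition ncopy K H q Phi n := nsets K n + nelts H q Phi n.

(** Elements are pairwise non-adjacent: an element taken into a dominating set covers no element but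
    itself. This is why the idle component b suffices against such choices. *)
Definition adj_in_copy (M : seq bool) k K q A U Phi n x y :=
  if x < nsets K n then
    if y < nsets K n then ~~ (x == y) else incident M k q A U Phi n x (y - nsets K n)
  else (y < nsets K n) && incident M k q A U Phi n y (x - nsets K n).

Definition adj_nat (M : seq bool) k K H q A U Phi n x y :=
  let V := ncopy K H q Phi n in
  (x %/ V == y %/ V) && adj_in_copy M k K q A U Phi n (x %% V) (y %% V).

Section Computability.
Variable d : nat.
Notation cm := (cmp true d).
Notation cmb := (fun b : seq bool -> valuation -> bool => cmp true d (fun M rho => b M rho : nat)).

Lemma cmp_hash fq fR fp fw : cm fq -> cm fR -> cm fp -> cm fw ->
  cm (fun M rho => hash (fq M rho) (fR M rho) (fp M rho) (fw M rho)).
Proof.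
by move=> *; apply: cmp_div => //; apply: cmp_mod; apply: cmp_mul.
Qed.

Lemma cmp_answers fk fq fn fp fu fe fw : cm fk -> cm fq -> cm fn -> cm fp -> cm fu -> cm fe -> cm fw ->
  cmb (fun M rho => answers (fk M rho) (fq M rho) (fn M rho) (fp M rho) (fu M rho) (fe M rho) (fw M rho)).
Proof.
move=> ck cq cn cp cu ce cw; rewrite /answers.
have cR : cm (fun M rho => (fn M rho * fn M rho).+1) by apply/cmp_S/cmp_mul.
have cg : cm (fun M rho => fu M rho %/ fq M rho) by apply: cmp_div.
have ct : cm (fun M rho => fu M rho %% fq M rho) by apply: cmp_mod.
have ce' : cm (fun M rho => fu M rho %/ fq M rho %/ 2) by apply: cmp_div => //; apply: cmp_const.
have cb : cmb (fun M rho => fu M rho %/ fq M rho %% 2 == 0).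
  by apply: cmp_eq; [apply: cmp_mod => //|]; apply: cmp_const.
have ci : cm (fun M rho => if fu M rho %/ fq M rho %% 2 == 0 then fu M rho %/ fq M rho %/ 2 %/ fk M rho
   else fu M rho %/ fq M rho %/ 2 %% fk M rho).
  by apply: cmp_if => //; [apply: cmp_div|apply: cmp_mod].
apply: cmp_or; apply: cmp_and.
- exact: cmp_eq.
- apply: cmp_eq => //; apply: cmp_hash => //; apply: cmp_if => //; [exact: cmp_div|exact: cmp_mod].
- by apply: cmp_eq => //; apply: cmp_add => //; apply: cmp_mul.
- by apply: cmp_not; apply: cmp_eq => //; apply: cmp_hash => //; apply: cmp_div.
Qed.

Lemma cmp_admissible fk fe fw : cm fk -> cm fe -> cm fw ->
  cmb (fun M rho => admissible M (fk M rho) (fe M rho) (fw M rho)).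
Proof.
move=> ck ce cw; apply: cmp_or; last exact: cmp_get.
by apply: cmp_eq; [apply: cmp_div|apply: cmp_mod].
Qed.

End Computability.

Lemma cmp_incident d fk fq fA fU fP fn fs fz :
  cmp true d fk -> cmp true d fq -> cmp true d fA -> cmp true d fU -> cmp true d fP ->
  cmp true d fn -> cmp true d fs -> cmp true d fz ->
  cmp true d (fun M rho => incident M (fk M rho) (fq M rho) (fA M rho) (fU M rho) (fP M rho)
    (fn M rho) (fs M rho) (fz M rho) : nat).
Proof.
move=> ck cq cA cU cP cn cs cz; rewrite /incident.
have cnn : cmp true d (fun M rho => fn M rho * fn M rho) by apply: cmp_mul.
have cR : cmp true d (fun M rho => (fn M rho * fn M rho).+1) by apply: cmp_S.
have ce : cmp true d (fun M rho => fs M rho %/ (fn M rho * fn M rho)) by apply: cmp_div.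
have cw : cmp true d (fun M rho => fs M rho %% (fn M rho * fn M rho)) by apply: cmp_mod.
have cF : cmp true d (fun M rho => fz M rho %% fP M rho) by apply: cmp_mod.
have cp : cmp true d (fun M rho => fz M rho %/ fP M rho %% (fq M rho * (fn M rho * fn M rho).+1)).
  by apply: cmp_mod; [apply: cmp_div|apply: cmp_mul].
apply: cmp_and; first exact: cmp_admissible.
apply: (cmp_exists (P := fun M rho a =>
  (digit (fq M rho) (fs M rho %/ (fn M rho * fn M rho)) a ==
   hash (fq M rho) (fn M rho * fn M rho).+1 (fz M rho %/ fP M rho %% (fq M rho * (fn M rho * fn M rho).+1))
     (fs M rho %% (fn M rho * fn M rho))) &&
  answers (fk M rho) (fq M rho) (fn M rho) (fz M rho %/ fP M rho %% (fq M rho * (fn M rho * fn M rho).+1))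
    (digit (fU M rho) a (fz M rho %% fP M rho)) (fs M rho %/ (fn M rho * fn M rho))
    (fs M rho %% (fn M rho * fn M rho)))) => //.
- move=> v M rho rho' h /=.
  by rewrite (ck.1 _ _ _ h) (cq.1 _ _ _ h) (cU.1 _ _ _ h) (cP.1 _ _ _ h) (cn.1 _ _ _ h)
    (cs.1 _ _ _ h) (cz.1 _ _ _ h).
- move=> D x hD hx; have mono f : cmp true d f -> cmp true D f by apply: cmp_mono.
  apply: cmp_and; first apply: cmp_eq.
  + by apply: cmp_digit; [exact: mono|exact: mono|exact: cmp_var].
  + by apply: cmp_hash; exact: mono.
  + by apply: cmp_answers; try exact: mono; apply: cmp_digit; [exact: mono|exact: cmp_var|exact: mono].
Qed.

Lemma cmp_nsets p d fK fn : cmp p d fK -> cmp p d fn -> cmp p d (fun M rho => nsets (fK M rho) (fn M rho)).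
Proof. by move=> cK cn; apply: cmp_mul => //; apply: cmp_mul. Qed.

Lemma cmp_ncopy p d fK fH fq fP fn : cmp p d fK -> cmp p d fH -> cmp p d fq -> cmp p d fP ->
  cmp p d fn -> cmp p d (fun M rho => ncopy (fK M rho) (fH M rho) (fq M rho) (fP M rho) (fn M rho)).
Proof.
move=> cK cH cq cP cn; apply: cmp_add; first exact: cmp_nsets.
by apply: cmp_mul => //; apply: cmp_mul => //; apply: cmp_mul => //; apply/cmp_S/cmp_mul.
Qed.

Lemma cmp_adj_in_copy d fk fK fq fA fU fP fn fx fy :
  cmp true d fk -> cmp true d fK -> cmp true d fq -> cmp true d fA -> cmp true d fU -> cmp true d fP ->
  cmp true d fn -> cmp true d fx -> cmp true d fy ->
  cmp true d (fun M rho => adj_in_copy M (fk M rho) (fK M rho) (fq M rho) (fA M rho) (fU M rho)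
    (fP M rho) (fn M rho) (fx M rho) (fy M rho) : nat).
Proof.
move=> ck cK cq cA cU cP cn cx cy; rewrite /adj_in_copy.
have cS := cmp_nsets cK cn.
have cxS : cmp true d (fun M rho => fx M rho < nsets (fK M rho) (fn M rho) : nat).
  by apply: cmp_leq => //; apply: cmp_S.
have cyS : cmp true d (fun M rho => fy M rho < nsets (fK M rho) (fn M rho) : nat).
  by apply: cmp_leq => //; apply: cmp_S.
apply: cmp_ifb => //; [apply: cmp_ifb => //|].
- by apply/cmp_not/cmp_eq.
- by apply: cmp_incident => //; apply: cmp_sub.
- by apply: cmp_and => //; apply: cmp_incident => //; apply: cmp_sub.
Qed.

Lemma cmp_adj_nat d fk fK fH fq fA fU fP fn fx fy :
  cmp true d fk -> cmp true d fK -> cmp true d fH -> cmp true d fq -> cmp true d fA ->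
  cmp true d fU -> cmp true d fP -> cmp true d fn -> cmp true d fx -> cmp true d fy ->
  cmp true d (fun M rho => adj_nat M (fk M rho) (fK M rho) (fH M rho) (fq M rho) (fA M rho) (fU M rho)
    (fP M rho) (fn M rho) (fx M rho) (fy M rho) : nat).
Proof.
move=> ck cK cH cq cA cU cP cn cx cy; have cV := cmp_ncopy cK cH cq cP cn.
apply: cmp_and; first by apply: cmp_eq; apply: cmp_div.
by apply: cmp_adj_in_copy => //; apply: cmp_mod.
Qed.

Definition kK k := k * k.
Definition kH k c := c * kK k.
(** Fewer than [H] pairs yield at most 3 [H] numbers to separate (each pair and its two
    coordinates), hence 9 [H]^2 ordered pairs of numbers, each colliding for at most 5 R of the q R
    multipliers; 45 = 5 * 9. *)
Definition kq k c := (45 * (kH k c * kH k c)).+1.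
Definition kA k c := kq k c ^ kK k.
(** The number of challenges: a side, a colour and a hash value. *)
Definition kU k c := 2 * kK k * kq k c.
Definition kPhi k c := kU k c ^ kA k c.
Definition kM k c := dpar k c ^ c %/ kK k.

(** For c = 0 and k > 1 there are no copies, because d^0 = 1 is smaller than k^2; the last summand
    leaves a single vertex. *)
Definition out_size k c n := kM k c * ncopy (kK k) (kH k c) (kq k c) (kPhi k c) n + (c == 0).
Definition out_adj M k c n x y :=
  adj_nat M k (kK k) (kH k c) (kq k c) (kA k c) (kU k c) (kPhi k c) n x y.

Theorem reduction_machine : exists (M : TM) (a : nat) (f : nat -> nat -> nat),
  computable2 f /\ forall n bits k c, size bits = n * n ->
  let N := out_size k c n in
  outputs_within M (enc_nat n ++ bits ++ enc_nat k ++ enc_nat c) (f k c * n.+1 ^ a)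
    (enc_nat N ++ [seq out_adj bits k c n (v %/ N) (v %% N) | v <- iota 0 (N * N)]).
Proof.
(* Registers 0 to 8 hold k, c, K, H, q, A, U, Phi and the number of copies; 9, 10 and 11 will hold
   n, the output size and the index of the printed bit. *)
pose fs : seq fn := [::
  (fun _ rho => rho 0 * rho 0);
  (fun _ rho => rho 1 * rho 2);
  (fun _ rho => (45 * (rho 3 * rho 3)).+1);
  (fun _ rho => rho 4 ^ rho 2);
  (fun _ rho => 2 * rho 2 * rho 4);
  (fun _ rho => rho 6 ^ rho 5);
  (fun _ rho => dpar (rho 0) (rho 1) ^ rho 1 %/ rho 2)].
pose fN : fn := fun _ rho => rho 8 * ncopy (rho 2) (rho 3) (rho 4) (rho 7) (rho 9) + (rho 1 == 0).
pose adj M rho := adj_nat M (rho 0) (rho 2) (rho 3) (rho 4) (rho 5) (rho 6) (rho 7) (rho 9)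
  (rho 11 %/ rho 10) (rho 11 %% rho 10).
have ok : consts_ok 2 fs.
  have cv d x : x < d -> cmp false d (fun _ rho => rho x) by apply: cmp_var.
  do 6 (split; first by repeat first [apply: cv|apply: cmp_const|apply: cmp_S|apply: cmp_mul|apply: cmp_exp]).
  split=> //; rewrite /dpar.
  by repeat first [apply: cv => //|apply: cmp_const|apply: cmp_div|apply: cmp_exp|apply: cmp_mul|apply: cmp_add].
have cN : cmp true 10 fN.
  apply: cmp_add; first by apply: cmp_mul; [apply: cmp_var|apply: cmp_ncopy; apply: cmp_var].
  by apply: cmp_eq; [apply: cmp_var|apply: cmp_const].
have ca : cmp true 12 (fun M rho => adj M rho : nat).
  by apply: cmp_adj_nat; try exact: cmp_var; [apply: cmp_div|apply: cmp_mod]; apply: cmp_var.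
have [M [a [f [hf h]]]] := printing_machine ok cN ca.
exists M, a, f; split=> // n bits k c hb; exact: h hb.
Qed.

(** * Hashing *)

(** Two remainders in the same block of length [R] differ by less than [R]; adding [R] keeps their
    difference a natural number. *)
Lemma block_difference R x x' u u' a b dl : x = u + a -> x' = u' + b -> u <= u' ->
  dl = x' - x -> a %/ R = b %/ R -> 0 < R -> x <= x' ->
  R + b - a < 2 * R /\ dl + R = u' - u + (R + b - a).
Proof.
move=> ex ex' le edl eh R0 lex.
have := divn_eq a R; have := divn_eq b R; rewrite eh.
have := ltn_pmod a R0; have := ltn_pmod b R0.
by move: (a %% R) (b %% R) (b %/ R * R) => a' b' s; lia.
Qed.

(* If [p * w] and [p * w'] fall in the same block of length [R] modulo [q * R], then
   [p * delta] is within [R] of a multiple [j * (q * R)] with [j <= delta], and for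
   each [j] such [p] are determined by the offset up to [delta]. *)
Lemma hash_collisions_lt q R w w' : w < w' -> w' < R ->
  #|[set p : 'I_(q * R) | hash q R p w == hash q R p w']| <= 5 * R.
Proof.
move=> lt ltR; set Q := q * R; pose dl := w' - w.
have d0 : 0 < dl by rewrite subn_gt0.
have R0 : 0 < R by lia.
pose j (p : nat) := (p * w') %/ Q - (p * w) %/ Q.
pose r (p : nat) := R + (p * w') %% Q - (p * w) %% Q.
have key p : p < Q -> hash q R p w == hash q R p w' ->
   [/\ j p <= dl, r p < 2 * R & p * dl + R = j p * Q + r p].
  move=> pQ /eqP; rewrite /hash -/Q => eh.
  have lpw : p * w <= p * w' by rewrite leq_mul2l ltnW ?orbT.
  have epd : p * dl = p * w' - p * w by rewrite mulnBr.
  have le : (p * w) %/ Q <= (p * w') %/ Q by apply: leq_div2r.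
  have Q0 : 0 < Q by apply: leq_ltn_trans pQ.
  have aQ : (p * w) %% Q < Q by rewrite ltn_pmod.
  have [rR e3] : r p < 2 * R /\ p * dl + R = j p * Q + r p.
    rewrite /r /j mulnBl; apply: (block_difference (divn_eq _ _) (divn_eq _ _) _ _ eh R0) => //.
    by rewrite leq_mul2r le orbT.
  split=> //; rewrite -ltnS -(@ltn_pmul2r Q) //.
  have h1 : p * dl + dl <= dl * Q by rewrite -mulSnr mulnC leq_mul2l pQ orbT.
  have h2 : R <= r p + (p * w) %% Q by rewrite /r; move: (_ %% _) (_ %% _); clear; lia.
  by rewrite mulSn; move: (dl * Q) (p * dl) (j p * Q) (r p) ((p * w) %% Q) aQ e3 h1 h2 d0; clear; lia.
(* Two multipliers with the same code have products with [dl] that differ by less than [dl], hence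
   are equal. *)
pose g (p : 'I_Q) : 'I_dl.+1 * 'I_((2 * R) %/ dl).+1 := (inord (j p), inord (r p %/ dl)).
set S := [set p : 'I_Q | _].
have ginj : {in S &, injective g}.
  move=> p p'; rewrite !inE => /(key _ (ltn_ord p))[j1 r1 e1] /(key _ (ltn_ord p'))[j2 r2 e2] [].
  have b1 : r p %/ dl <= (2 * R) %/ dl by apply: leq_div2r; lia.
  have b2 : r p' %/ dl <= (2 * R) %/ dl by apply: leq_div2r; lia.
  move=> /(congr1 val) /=; rewrite !inordK // => ej /(congr1 val) /=; rewrite !inordK // => er.
  have m1 := divn_eq (r p) dl; have m2 := divn_eq (r p') dl.
  have l1 : r p %% dl < dl by rewrite ltn_pmod.
  have l2 : r p' %% dl < dl by rewrite ltn_pmod.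
  rewrite ej in e1; rewrite er in m1; apply: val_inj => /=.
  move: m1 m2 l1 l2 e1 e2; clear -d0.
  move: (r p %% dl) (r p' %% dl) (r p' %/ dl * dl) (r p) (r p') (j p' * Q) => a b c rp rp' jQ.
  move=> m1 m2 l1 l2 e1 e2.
  have [lt1|lt1|//] := ltngtP p p'.
    have : p.+1 * dl <= p' * dl by rewrite leq_mul2r lt1 orbT.
    by rewrite mulSn; move: (p * dl) (p' * dl) e1 e2; lia.
  have : p'.+1 * dl <= p * dl by rewrite leq_mul2r lt1 orbT.
  by rewrite mulSn; move: (p * dl) (p' * dl) e1 e2; lia.
rewrite -(card_in_imset ginj); apply: leq_trans (max_card _) _.
(* The number of codes is at most 2R + 2R + dl + 1, and dl < R. *)
rewrite card_prod !card_ord mulnSr [dl.+1 * _]mulSn.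
have : dl * ((2 * R) %/ dl) <= 2 * R by rewrite mulnC leq_divM.
have : (2 * R) %/ dl <= 2 * R by apply: leq_div.
have : dl < R by rewrite /dl; lia.
by move: (_ %/ dl) => X; move: (dl * X); clear; lia.
Qed.

Lemma hash_collisions q R w w' : w != w' -> w < R -> w' < R ->
  #|[set p : 'I_(q * R) | hash q R p w == hash q R p w']| <= 5 * R.
Proof.
case: (ltngtP w w') => // lt _ h1 h2; first exact: hash_collisions_lt.
apply: leq_trans (hash_collisions_lt q lt h1).
by apply/subset_leq_card/subsetP => p; rewrite !inE eq_sym.
Qed.

Lemma card_has (T : finType) (I : Type) (P : I -> pred T) (s : seq I) b :
  (forall i, #|[set x | P i x]| <= b) -> #|[set x | has (fun i => P i x) s]| <= size s * b.
Proof.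
move=> h; elim: s => [|i s ih] /=.
  by rewrite leqn0 cards_eq0; apply/eqP/setP => x; rewrite !inE.
rewrite mulSn; apply: leq_trans (leq_add (h i) ih).
apply: leq_trans (leq_card_setU _ _); apply: subset_leq_card.
by apply/subsetP => x; rewrite !inE.
Qed.

(** Union bound: every ordered pair from [ws] spoils at most 5 R of the q R multipliers. *)
Lemma separating_hash q R (ws : seq nat) : 0 < R -> {in ws, forall w, w < R} ->
  5 * (size ws * size ws) < q ->
  exists2 p, p < q * R & {in ws &, injective (hash q R p)}.
Proof.
move=> R0 hR hq.
(* The side conditions are part of [P] because [card_has] wants the bound for all pairs of numbers,
   not only those from [ws]. *)
pose P (pr : nat * nat) (p : 'I_(q * R)) := [&& pr.1 != pr.2, pr.1 < R, pr.2 < R &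
  hash q R p pr.1 == hash q R p pr.2].
pose bad := [set p | has (fun pr => P pr p) [seq (x, y) | x <- ws, y <- ws]].
have : #|bad| < q * R.
  apply: leq_ltn_trans (card_has _ (b := 5 * R) _) _.
    move=> [w w'] /=; case: (boolP [&& w != w', w < R & w' < R]) => [/and3P[h1 h2 h3]|h].
      by rewrite /P /= h1 h2 h3; apply: hash_collisions.
    rewrite (_ : [set x | _] = set0) ?cards0 //; apply/setP => p; rewrite !inE /P /=.
    by apply/negbTE; apply: contra h => /and4P[-> -> ->].
  by rewrite size_allpairs mulnA ltn_pmul2r // mulnC.
move=> lt; have /subsetPn[p _] : ~~ ([set: 'I_(q * R)] \subset bad).
  by apply: contraL lt => /subset_leq_card; rewrite cardsT card_ord -leqNgt.
rewrite inE => /hasPn hp; exists p => // w w' hw hw' e; apply/eqP.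
have /hp : (w, w') \in [seq (x, y) | x <- ws, y <- ws] by apply/allpairsP; exists (w, w').
by rewrite /P /= !hR //= e eqxx andbT negbK.
Qed.

(** * Digits *)

Lemma ltn_digit q i a : 0 < q -> digit q i a < q.
Proof. exact: ltn_pmod. Qed.

Lemma digitS q i a : digit q i.+1 a = digit q i (a %/ q).
Proof. by rewrite /digit iterSr. Qed.

Lemma digits_exist q N (u : nat -> nat) : (forall i, i < N -> u i < q) ->
  exists2 a, a < q ^ N & forall i, i < N -> digit q i a = u i.
Proof.
elim: N u => [|N ih] u hu; first by exists 0.
have [|a ha e] := ih (fun i => u i.+1); first by move=> i hi; apply: hu.
have q0 : 0 < q by apply: leq_ltn_trans (hu 0 isT).
exists (a * q + u 0) => [|[|i] hi].
- by have := hu 0 isT; rewrite expnSr => h; apply: (@leq_trans (a.+1 * q)); rewrite ?leq_mul2r ?ha ?orbT // mulSn; lia.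
- by rewrite /digit /= modnMDl modn_small // hu.
- by rewrite digitS divnMDl // divn_small ?addn0 ?hu // e.
Qed.

(** * Unanswered challenges *)

Section Challenge.
Variables (M : seq bool) (k q n p : nat) (S : seq (nat * nat)) (r : nat -> nat).
Let R := (n * n).+1.
Let K := k * k.
Hypotheses (k_gt0 : 0 < k) (q_gt0 : 0 < q)
  (S_vertex : forall e w, (e, w) \in S -> w < n * n)
  (inj_w : forall e w e' w', (e, w) \in S -> (e', w') \in S -> hash q R p w = hash q R p w' -> w = w')
  (inj_row : forall e w e' w', (e, w) \in S -> (e', w') \in S ->
     hash q R p (w %/ n) = hash q R p (w' %/ n) -> w %/ n = w' %/ n)
  (inj_col : forall e w e' w', (e, w) \in S -> (e', w') \in S ->
     hash q R p (w %% n) = hash q R p (w' %/ n) -> w %% n = w' %/ n).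

Let chosen e w := [&& (e, w) \in S, admissible M k e w & r e == hash q R p w].

Lemma chosen_uniq e w w' : chosen e w -> chosen e w' -> w = w'.
Proof. by move=> /and3P[h1 _ /eqP h2] /and3P[h3 _ /eqP h4]; apply: inj_w h1 h3 _; rewrite -h2. Qed.

Lemma ltn_hash w : 0 < q -> hash q R p w < q.
Proof. by move=> q0; rewrite /hash ltn_divLR // ltn_pmod // muln_gt0 q0. Qed.

Definition challenge e side t := (e * 2 + side) * q + t.

Lemma challenge_lt e side t : e < K -> side < 2 -> t < q -> challenge e side t < 2 * K * q.
Proof.
move=> he hs ht; apply: (@leq_trans ((e * 2 + side).+1 * q)); first by rewrite /challenge mulSn; lia.
by rewrite leq_mul2r; apply/orP; right; lia.
Qed.

Lemma answers_challenge e' side t e w : side < 2 -> t < q ->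
  answers k q n p (challenge e' side t) e w =
  let i' := if side == 0 then e' %/ k else e' %% k in
  (e == e') && (hash q R p (if side == 0 then w %/ n else w %% n) == t) ||
  (e == i' * k + i') && ~~ (hash q R p (w %/ n) == t).
Proof.
move=> hs ht.
have e1 : challenge e' side t %/ q = e' * 2 + side by rewrite divnMDl // (divn_small ht) addn0.
have e2 : challenge e' side t %% q = t by rewrite modnMDl (modn_small ht).
have e3 : (e' * 2 + side) %/ 2 = e' by rewrite divnMDl // (divn_small hs) addn0.
have e4 : (e' * 2 + side) %% 2 = side by rewrite modnMDl (modn_small hs).
by rewrite /answers e1 e2 e3 e4.
Qed.

(** The tuple [r] and injectivity of the hash leave at most one chosen pair per colour. The
    challenges force the pair of colour (i, j) to consist of the vertices of the diagonal pairs of i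
    and j, and admissibility then makes these adjacent. *)
Lemma clique_of_answers :
  (forall u, u < 2 * K * q -> exists e w, chosen e w /\ answers k q n p u e w) ->
  exists v : nat -> nat, (forall i, i < k -> v i < n) /\
    forall i j, i < k -> j < k -> i != j -> nth false M (v i * n + v j).
Proof.
move=> hall.
have colour i j : i < k -> j < k -> i * k + j < K.
  move=> hi hj; have : i.+1 * k <= k * k by rewrite leq_mul2r hi orbT.
  by rewrite mulSn -/K; move: (i * k) => u; lia.
(* For a challenge at a diagonal colour both alternatives concern that same colour, so some pair of
   it is chosen. *)
have dg i : i < k -> exists w, chosen (i * k + i) w.
  move=> hi; have [e [w [hw]]] := hall _ (challenge_lt (colour i i hi hi) (isT : 0 < 2) q_gt0).
  rewrite answers_challenge //= divnMDl // (divn_small hi) addn0.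
  by case/orP => /andP[/eqP e1 _]; exists w; rewrite -e1.
pose W i := if [pick w : 'I_(n * n) | chosen (i * k + i) w] is Some w then val w else 0.
have hW i : i < k -> chosen (i * k + i) (W i).
  move=> /dg[w hw]; rewrite /W; case: pickP => [w' //|no].
  have wn : w < n * n by case/and3P: hw => /S_vertex.
  by have := no (Ordinal wn); rewrite /= hw.
have n0 i : i < k -> 0 < n.
  by move/hW => /and3P[/S_vertex h _ _]; case: (n) h.
exists (fun i => W i %/ n); split.
  move=> i hi; rewrite ltn_divLR ?(n0 i) //.
  by have /and3P[/S_vertex] := hW i hi.
move=> i j hi hj ij.
(* The challenge uses the hash of the vertex at i itself. The only chosen pair of the diagonal
   colour has that hash and cannot answer, so a pair of colour (i, j) does. *)
have [w1 [c1 r1]] : exists w, chosen (i * k + j) w /\ w %/ n = W i %/ n.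
  have [e [w [hw]]] := hall _ (challenge_lt (colour i j hi hj) (isT : 0 < 2) (ltn_hash (W i %/ n) q_gt0)).
  rewrite answers_challenge ?ltn_hash //= divnMDl // (divn_small hj) addn0.
  case/orP => /andP[/eqP e1]; rewrite e1 in hw.
    move=> /eqP h; exists w; split=> //.
    have /and3P[s1 _ _] := hw; have /and3P[s2 _ _] := hW i hi.
    exact: inj_row s1 s2 h.
  by rewrite (chosen_uniq hw (hW i hi)) eqxx.
have [w2 [c2 r2]] : exists w, chosen (i * k + j) w /\ w %% n = W j %/ n.
  have [e [w [hw]]] := hall _ (challenge_lt (colour i j hi hj) (isT : 1 < 2) (ltn_hash (W j %/ n) q_gt0)).
  rewrite answers_challenge ?ltn_hash //= modnMDl (modn_small hj).
  case/orP => /andP[/eqP e1]; rewrite e1 in hw.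
    move=> /eqP h; exists w; split=> //.
    have /and3P[s1 _ _] := hw; have /and3P[s2 _ _] := hW j hj.
    exact: inj_col s1 s2 h.
  by rewrite (chosen_uniq hw (hW j hj)) eqxx.
have e := chosen_uniq c2 c1; rewrite -r1 -r2 e -divn_eq.
have /and3P[_ + _] := c1; rewrite /admissible divnMDl // (divn_small hj) addn0 modnMDl (modn_small hj).
by rewrite (negPf ij).
Qed.

End Challenge.

(** * Domination numbers *)

Lemma bigmin_leq (T : eqType) (s : seq T) (P : pred T) (F : T -> nat) n x :
  x \in s -> P x -> \big[minn/n]_(i <- s | P i) F i <= F x.
Proof.
elim: s => // y s ih; rewrite inE big_cons => /orP[/eqP-> ->|xs Px]; first exact: geq_minl.
by case: ifP => _; [rewrite geq_min ih ?orbT|apply: ih].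
Qed.

Lemma domnum_leq G (D : {set 'I_(gn G)}) : dominating D -> domnum G <= #|D|.
Proof. by move=> h; apply: bigmin_leq => //; rewrite mem_index_enum. Qed.

Lemma leq_domnum G L : (forall D : {set 'I_(gn G)}, dominating D -> L <= #|D|) -> L <= domnum G.
Proof.
(* The initial value of the minimum has to be bounded too; the full vertex set does it. *)
move=> h; have hn : L <= gn G.
  by rewrite -[gn G]card_ord -cardsT; apply: h; apply/forallP => v; rewrite inE.
by rewrite /domnum; elim/big_rec: _ => // D x /h; rewrite leq_min => -> ->.
Qed.

(** * Encodings *)

Lemma allpairs_iota T (f : nat -> nat -> T) m N :
  [seq f i j | i <- iota 0 m, j <- iota 0 N] = [seq f (v %/ N) (v %% N) | v <- iota 0 (m * N)].
Proof.
elim: m => [|m ih]; first by rewrite mul0n.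
rewrite -addn1 iotaD allpairs_cat ih mulnDl iotaD map_cat; congr (_ ++ _).
have -> : iota (0 + m * N) (1 * N) = map (addn (m * N)) (iota 0 N) by rewrite -iotaDl addn0 mul1n.
rewrite /= cats0 add0n -map_comp.
apply/eq_in_map => v; rewrite mem_iota /= add0n => hv.
have N0 : 0 < N by apply: leq_ltn_trans hv.
by rewrite divnMDl // (divn_small hv) addn0 modnMDl (modn_small hv).
Qed.

Lemma allpairs_enum T (f : nat -> nat -> T) N :
  [seq f (val i) (val j) | i : 'I_N <- enum 'I_N, j : 'I_N <- enum 'I_N] = [seq f (v %/ N) (v %% N) | v <- iota 0 (N * N)].
Proof. by rewrite -allpairs_iota -val_enum_ord allpairs_mapl allpairs_mapr. Qed.

Definition adj_bits G := [seq @gadj G i j | i <- enum 'I_(gn G), j <- enum 'I_(gn G)].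

Lemma size_adj_bits G : size (adj_bits G) = gn G * gn G.
Proof. by rewrite size_allpairs size_enum_ord. Qed.

Lemma nth_adj_bits G (i j : 'I_(gn G)) : nth false (adj_bits G) (i * gn G + j) = gadj i j.
Proof.
(* Adjacency is extended to all numbers so that the positions can be computed by division. *)
pose f x y := if insub x is Some i then if insub y is Some j then @gadj G i j else false else false.
have -> : adj_bits G = [seq f (val i) (val j) | i : 'I_(gn G) <- enum 'I_(gn G), j : 'I_(gn G) <- enum 'I_(gn G)].
  by apply: eq_allpairs => x y; rewrite /f !valK.
rewrite (allpairs_enum f).
have n0 : 0 < gn G by apply: leq_ltn_trans (ltn_ord i).
have lt : i * gn G + j < gn G * gn G.
  have : i.+1 * gn G <= gn G * gn G by rewrite leq_mul2r ltn_ord orbT.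
  by rewrite mulSn; have := ltn_ord j; lia.
rewrite (nth_map 0) ?size_iota // nth_iota // add0n divnMDl // (divn_small (ltn_ord j)) addn0.
by rewrite modnMDl (modn_small (ltn_ord j)) /f !valK.
Qed.

Lemma clique_of_bits G k (v : nat -> nat) : (forall i, i < k -> v i < gn G) ->
  (forall i j, i < k -> j < k -> i != j -> nth false (adj_bits G) (v i * gn G + v j)) ->
  has_clique G k.
Proof.
move=> hv hadj.
pose vi (i : 'I_k) := Ordinal (hv i (ltn_ord i)).
have adj i j : i != j -> gadj (vi i) (vi j).
  by move=> ij; rewrite -nth_adj_bits; apply: hadj.
have inj : injective vi.
  move=> i j e; apply/eqP; apply/negPn/negP => /adj.
  by rewrite e girr.
exists [set vi i | i : 'I_k]; split; first by rewrite card_imset // card_ord.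
move=> u w /imsetP[i _ ->] /imsetP[j _ ->] ne; apply: adj.
by apply: contra ne => /eqP ->.
Qed.

Lemma bits_of_clique G k : has_clique G k -> exists v : nat -> nat,
  (forall i, i < k -> v i < gn G) /\
  (forall i j, i < k -> j < k -> i != j -> nth false (adj_bits G) (v i * gn G + v j)).
Proof.
case=> S [<- hS]; pose s := enum S.
have szs : size s = #|S| by rewrite cardE.
case E: s => [|x0 s'].
  by exists (fun _ => 0); split=> i; rewrite -szs E.
have mem i : i < #|S| -> nth x0 s i \in S by move=> hi; rewrite -mem_enum mem_nth // szs.
exists (fun i => val (nth x0 s i)); split=> [i hi|i j hi hj ij]; first exact: ltn_ord.
rewrite nth_adj_bits; apply: hS; rewrite ?mem //.
by rewrite nth_uniq ?szs // enum_uniq.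
Qed.

(** * The output graph *)

Section Output.
Variables (G : graph) (k c : nat).
Let n := gn G.
Let K := kK k.
Let H := kH k c.
Let q := kq k c.
Let A := kA k c.
Let U := kU k c.
Let Phi := kPhi k c.
Let m := kM k c.
Let V := ncopy K H q Phi n.
Let N := out_size k c n.
Let R := (n * n).+1.
Let Sz := nsets K n.

Lemma adj_in_copyC M x y : adj_in_copy M k K q A U Phi n x y = adj_in_copy M k K q A U Phi n y x.
Proof. by rewrite /adj_in_copy; do 2 case: (_ < nsets _ _) => //=; rewrite eq_sym. Qed.

Lemma adj_in_copyxx M x : adj_in_copy M k K q A U Phi n x x = false.
Proof. by rewrite /adj_in_copy; case: (_ < nsets _ _); rewrite ?eqxx. Qed.

Definition out_rel : rel 'I_N := fun x y => out_adj (adj_bits G) k c n x y.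

Lemma out_rel_sym : symmetric out_rel.
Proof. by move=> x y; rewrite /out_rel /out_adj /adj_nat adj_in_copyC eq_sym. Qed.

Lemma out_rel_irr : irreflexive out_rel.
Proof. by move=> x; rewrite /out_rel /out_adj /adj_nat adj_in_copyxx andbF. Qed.

Definition out_graph := Graph out_rel_sym out_rel_irr.

Lemma enc_out_graph : enc_graph out_graph =
  enc_nat N ++ [seq out_adj (adj_bits G) k c n (v %/ N) (v %% N) | v <- iota 0 (N * N)].
Proof. by rewrite /enc_graph -(allpairs_enum (out_adj (adj_bits G) k c n)). Qed.

Hypotheses (k_gt0 : 0 < k) (c_gt0 : 0 < c).

Lemma K_gt0 : 0 < K. Proof. by rewrite muln_gt0 k_gt0. Qed.
Lemma q_gt0 : 0 < q. Proof. by []. Qed.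
Lemma U_gt0 : 0 < U. Proof. by rewrite !muln_gt0 k_gt0. Qed.
Lemma Phi_gt0 : 0 < Phi. Proof. by rewrite expn_gt0 U_gt0. Qed.

Lemma N_eq : N = m * V.
Proof. by rewrite /N /out_size (gtn_eqF c_gt0) addn0. Qed.

Lemma vertex_lt cp y : cp < m -> y < V -> cp * V + y < N.
Proof.
move=> h1 h2; rewrite N_eq; apply: (@leq_trans (cp.+1 * V)); first by rewrite mulSn addnC ltn_add2r.
by rewrite leq_mul2r h1 orbT.
Qed.

Lemma vertex_div cp y : y < V -> (cp * V + y) %/ V = cp.
Proof. by move=> h; rewrite divnMDl ?(leq_ltn_trans _ h) // divn_small // addn0. Qed.

Lemma vertex_mod cp y : y < V -> (cp * V + y) %% V = y.
Proof. by move=> h; rewrite modnMDl modn_small. Qed.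

(** Edges stay within a copy, so each copy has to be dominated by its own part of [D]. *)
Lemma copy_lower_bound (D : {set 'I_N}) cp : @dominating out_graph D -> ~ has_clique G k ->
  cp < m -> H <= #|[set x in D | x %/ V == cp]|.
Proof.
move=> dom nocl hcp; rewrite leqNgt; apply/negP => hlt; apply: nocl.
set C := [set x in D | _] in hlt.
pose L := [seq val x %% V | x <- enum C].
have szL : size L = #|C| by rewrite size_map -cardE.
pose S := [seq (y %/ (n * n), y %% (n * n)) | y <- L & y < Sz].
have szS : size S <= #|C| by rewrite size_map size_filter -szL count_size.
have S_in e w : (e, w) \in S -> e < K /\ w < n * n.
  case/mapP => y; rewrite mem_filter => /andP[hy _] [-> ->].
  have nn : 0 < n * n by move: hy; rewrite /Sz /nsets; case: (n * n); rewrite ?muln0.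
  by rewrite ltn_divLR // ltn_pmod.
(* Base vertices contribute a spurious 0 to this list; only its length, less than [H], matters. *)
have [b bH hb] : exists2 b, b < H & b \notin [seq (y - Sz) %/ (Phi * (q * R)) | y <- L].
  have /allPn[b] : ~~ all (fun b => b \in [seq (y - Sz) %/ (Phi * (q * R)) | y <- L]) (iota 0 H).
    apply: contraL hlt => /allP h; rewrite -leqNgt -szL -[X in X <= _](size_iota 0).
    by rewrite -[X in _ <= X](size_map (fun y => (y - Sz) %/ (Phi * (q * R)))) uniq_leq_size ?iota_uniq.
  by rewrite mem_iota add0n => /andP[_ ?]; exists b.
pose ws := flatten [seq [:: ew.2; ew.2 %/ n; ew.2 %% n] | ew <- S].
have szws : size ws = 3 * size S.
  by rewrite /ws; elim: (S) => // ew s ih; rewrite /= ih mulnS.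
have ws_in e w x : (e, w) \in S -> x \in [:: w; w %/ n; w %% n] -> x \in ws.
  by move=> h hx; apply/flattenP; exists [:: w; w %/ n; w %% n] => //; apply/mapP; exists (e, w).
have ws_lt x : x \in ws -> x < R.
  case/flattenP => l /mapP[[e w] /S_in[_ hw] ->]; rewrite !inE /= ltnS.
  case/or3P => /eqP ->; first exact: ltnW.
    by apply: leq_trans (leq_div _ _) (ltnW hw).
  by apply: leq_trans (leq_mod _ _) (ltnW hw).
have [|p pQ inj] := separating_hash (isT : 0 < R) ws_lt (q := q).
  rewrite szws /q /kq ltnS (_ : 5 * _ = 45 * (size S * size S)); last by lia.
  by rewrite leq_mul2l /= leq_mul //; apply: leq_trans szS (ltnW hlt).
pose unanswered a u := ~~ has (fun ew =>
  [&& admissible (adj_bits G) k ew.1 ew.2, digit q ew.1 a == hash q R p ew.2 &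
   answers k q n p u ew.1 ew.2]) S.
(* A tuple whose challenges are all answered yields a clique. Otherwise each tuple has an unanswered
   challenge, and these are the digits of [F]. *)
have [/allP hall|/allPn[a _]] := boolP (all (fun a => has (unanswered a) (iota 0 U)) (iota 0 A)); last first.
  move=> /hasPn h.
  suff [v [h1 h2]] : exists v : nat -> nat, (forall i, i < k -> v i < n) /\
      forall i j, i < k -> j < k -> i != j -> nth false (adj_bits G) (v i * n + v j).
    exact: clique_of_bits h1 h2.
  apply: (@clique_of_answers (adj_bits G) k q n p S (fun e => digit q e a)) => //.
  - by move=> e w /S_in[].
  - move=> e w e' w' h1 h2; apply: inj; [apply: (ws_in _ _ _ h1)|apply: (ws_in _ _ _ h2)]; by rewrite !inE eqxx.
  - move=> e w e' w' h1 h2; apply: inj; [apply: (ws_in _ _ _ h1)|apply: (ws_in _ _ _ h2)]; by rewrite !inE eqxx ?orbT.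
  - move=> e w e' w' h1 h2; apply: inj; [apply: (ws_in _ _ _ h1)|apply: (ws_in _ _ _ h2)]; by rewrite !inE eqxx ?orbT.
  - move=> u hu; have /h : u \in iota 0 U by rewrite mem_iota.
    rewrite negbK => /hasP[[e w] hS /and3P[h1 h2 h3]]; exists e, w; split=> //.
    by rewrite hS h1 h2.
pose uu a := find (unanswered a) (iota 0 U).
have uuP a : a < A -> uu a < U /\ unanswered a (uu a).
  move=> ha; have hh : has (unanswered a) (iota 0 U) by apply: hall; rewrite mem_iota.
  have lt : uu a < U by rewrite -[X in _ < X](size_iota 0) -has_find.
  by split=> //; have := nth_find 0 hh; rewrite -/(uu a) nth_iota.
have [F hF eF] := @digits_exist U A uu (fun a ha => (uuP a ha).1).
pose z := (b * (q * R) + p) * Phi + F.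
have e1 : z %% Phi = F by rewrite modnMDl modn_small.
have e2 : z %/ Phi = b * (q * R) + p by rewrite divnMDl ?Phi_gt0 // divn_small // addn0.
have QR0 : 0 < q * R by [].
have hz : z < nelts H q Phi n.
  rewrite /nelts mulnA -(@ltn_divLR _ _ _ Phi_gt0) e2.
  apply: (@leq_trans (b.+1 * (q * R))); first by rewrite mulSn addnC ltn_add2r.
  by rewrite leq_mul2r bH orbT.
have hy : Sz + z < V by rewrite ltn_add2l.
pose x0 : 'I_N := Ordinal (vertex_lt hcp hy).
have mem_L (y : 'I_N) : y \in D -> y %/ V = cp -> y %% V \in L.
  by move=> yD yV; apply/mapP; exists y => //; rewrite mem_enum inE yD yV eqxx.
(* If the element belongs to [D], its b occurs in the list; a neighbour in [D] is a base vertex of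
   this copy answering a challenge that was selected as unanswered. *)
have := forallP dom x0; case/orP => [x0D|/existsP[y /andP[yD]]].
  have := mem_L _ x0D (vertex_div cp hy); rewrite /= vertex_mod // => hL.
  case/negP: hb; apply/mapP; exists (Sz + z) => //.
  by rewrite addKn divnMA e2 divnMDl // divn_small ?addn0.
rewrite /= /out_rel /out_adj /adj_nat -/V /= vertex_div // vertex_mod //.
have nlt : (Sz + z < Sz) = false by rewrite ltnNge leq_addr.
case/andP => /eqP yV; rewrite /adj_in_copy -/Sz nlt addKn.
case: ltnP => // hyS; rewrite /incident -/R e1 e2 modnMDl (modn_small pQ).
case/andP => adm /hasP[a]; rewrite mem_iota add0n => /andP[_ ha] /andP[h1].
rewrite eF // => h2; have [_ /negP[]] := uuP a ha.
apply/hasP; exists (y %% V %/ (n * n), y %% V %% (n * n)); last by rewrite /= adm h1.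
by apply/mapP; exists (y %% V) => //; rewrite mem_filter hyS mem_L.
Qed.

Lemma dominated_of_clique : has_clique G k ->
  exists2 D : {set 'I_N}, @dominating out_graph D & #|D| <= m * K.
Proof.
case/bits_of_clique => v [hv0 hadj].
have hv i : i < k -> v i < n by apply: hv0.
pose w e := v (e %/ k) * n + v (e %% k).
have n0 : 0 < n by apply: leq_ltn_trans (hv 0 k_gt0).
have nn0 : 0 < n * n by rewrite muln_gt0 n0.
have ek e : e < K -> e %/ k < k by rewrite ltn_divLR.
have em e : e %% k < k by rewrite ltn_pmod.
have wrow e : e < K -> w e %/ n = v (e %/ k).
  by move=> he; rewrite divnMDl // (divn_small (hv _ (em e))) addn0.
have wcol e : e < K -> w e %% n = v (e %% k).
  by move=> he; rewrite modnMDl (modn_small (hv _ (em e))).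
have wlt e : e < K -> w e < n * n.
  by move=> he; rewrite -ltn_divLR // wrow // hv ?ek.
have diag i : i < k -> i * k + i < K.
  by move=> hi; rewrite -ltn_divLR // divnMDl // divn_small ?addn0.
pose s e := e * (n * n) + w e.
have sdiv e : e < K -> s e %/ (n * n) = e.
  by move=> he; rewrite divnMDl // divn_small ?addn0 // wlt.
have smod e : e < K -> s e %% (n * n) = w e.
  by move=> he; rewrite modnMDl modn_small // wlt.
have sS e : e < K -> s e < Sz by move=> he; rewrite /Sz /nsets -ltn_divLR // sdiv.
have sV e : e < K -> s e < V by move=> he; apply: leq_trans (sS e he) (leq_addr _ _).
pose g (ce : 'I_m * 'I_K) : 'I_N :=
  Ordinal (vertex_lt (ltn_ord ce.1) (sV _ (ltn_ord ce.2))).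
exists [set g ce | ce : 'I_m * 'I_K]; last first.
  by apply: leq_trans (leq_imset_card _ _) _; rewrite card_prod !card_ord.
apply/forallP => x; have V0 : 0 < V by apply: leq_ltn_trans (sV 0 K_gt0).
have cpm : x %/ V < m by rewrite ltn_divLR // -N_eq.
have adjP e (he : e < K) : adj_in_copy (adj_bits G) k K q A U Phi n (s e) (x %% V) ->
    [exists y in [set g ce | ce : 'I_m * 'I_K], @gadj out_graph y x].
  move=> h; apply/existsP; exists (g (Ordinal cpm, Ordinal he)).
  rewrite imset_f //= /out_rel /out_adj /adj_nat -/V /= vertex_div ?sV // eqxx.
  by rewrite vertex_mod ?sV.
have [xS|xS] := ltnP (x %% V) Sz.
  (* Base vertices are pairwise adjacent, so the one of colour 0 takes care of all of them. *)
  have [ex|ne] := eqVneq (x %% V) (s 0).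
    apply/orP; left; apply/imsetP; exists (Ordinal cpm, Ordinal K_gt0) => //.
    by apply: val_inj; rewrite /= -ex -divn_eq.
  apply/orP; right; apply: (adjP 0 K_gt0).
  by rewrite /adj_in_copy -/Sz sS ?K_gt0 // xS eq_sym.
apply/orP; right; set z := x %% V - Sz.
pose p := z %/ Phi %% (q * R).
(* The tuple of the hashes of the clique pairs makes all [K] base vertices compatible at once; only
   its challenge [u] remains to be answered. *)
have [a ha ea] := @digits_exist q K (fun e => hash q R p (w e)) (fun e _ => @ltn_hash q n p (w e) q_gt0).
set u := digit U a (z %% Phi).
have uU : u < 2 * K * q by apply: ltn_digit U_gt0.
have e'K : u %/ q %/ 2 < K by rewrite !ltn_divLR // mulnC (mulnC K) mulnC.
suff [e [he hans]] : exists e, e < K /\ answers k q n p u e (w e).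
  apply: (adjP e he); rewrite /adj_in_copy -/Sz sS // ltnNge xS /=.
  rewrite /incident sdiv // smod // -/R -/z -/p; apply/andP; split.
    rewrite /admissible; case: eqP => //= /eqP ne.
    by apply: hadj; rewrite ?ek ?em.
  by apply/hasP; exists a; [rewrite mem_iota|rewrite ea // eqxx].
pose e' := u %/ q %/ 2.
pose i' := if u %/ q %% 2 == 0 then e' %/ k else e' %% k.
have i'k : i' < k by rewrite /i'; case: ifP => _; [apply: ek|apply: em].
(* The named colour answers if the clique vertex at position [i'] hashes to the asked value, the
   diagonal colour of [i'] otherwise. *)
have [ht|ht] := boolP (hash q R p (v i') == u %% q).
  exists e'; split=> //; rewrite /answers -/e' eqxx /=.
  by move: ht; rewrite /i'; case: ifP => _; rewrite ?wrow ?wcol // => ->.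
exists (i' * k + i'); split; first exact: diag.
rewrite /answers -/e' -/i' eqxx wrow ?diag // divnMDl // (divn_small i'k) addn0 /=.
by rewrite ht orbT.
Qed.

End Output.

(** The number of copies is a rounded quotient by [kK k]; this makes the rounding loss negligible
    against d^c. *)
Lemma kK_leq k c : 0 < c -> 30 * kK k <= dpar k c ^ c.
Proof.
move=> c0; set X := 30 * c ^ 2 * (k + 1) ^ 2.
have h1 : 30 * kK k <= X.
  rewrite /X -mulnA leq_mul2l /=; apply: (@leq_trans ((k + 1) ^ 2)).
    by rewrite -mulnn leq_mul // leq_addr.
  by apply: leq_pmull; rewrite expn_gt0 c0.
have X0 : 0 < X by rewrite /X muln_gt0 muln_gt0 !expn_gt0 c0 addn1.
apply: leq_trans h1 _; rewrite /dpar -/X -expnM -[X in X <= _]expn1.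
have [X1|X1] := leqP X 1.
  have -> : X = 1 by apply/eqP; rewrite eqn_leq X1.
  by rewrite !exp1n.
by rewrite leq_exp2l // muln_gt0 c0 andbT; lia.
Qed.

Lemma domnum_gt0 G : 0 < gn G -> 0 < domnum G.
Proof.
move=> n0; apply: leq_domnum => D /forallP/(_ (Ordinal n0)); rewrite card_gt0.
by case/orP => [h|/existsP[u /andP[h _]]]; apply/set0Pn; [exists (Ordinal n0)|exists u].
Qed.

Lemma yes_case G k c : 2 < k -> has_clique G k -> 10 * domnum (out_graph G k c) < 11 * dpar k c ^ c.
Proof.
move=> k3 cl; have k0 : 0 < k by lia.
(* For c = 0 the bound is 10 gamma < 11, which holds because the graph has a single vertex. *)
case: (posnP c) => [->|c0].
  have -> : domnum (out_graph G k 0) <= 1 -> 10 * domnum (out_graph G k 0) < 11 * dpar k 0 ^ 0 by rewrite expn0; lia.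
  by [].
  have dom : @dominating (out_graph G k 0) setT by apply/forallP => x; rewrite inE.
  apply: leq_trans (domnum_leq dom) _; rewrite cardsT card_ord /= /out_size /kM expn0.
  by rewrite divn_small // /kK; nia.
have [D dom hD] := dominated_of_clique k0 c0 cl.
have h1 := domnum_leq dom; have h2 : kM k c * kK k <= dpar k c ^ c by apply: leq_divM.
have h3 := kK_leq k c0; have h4 : 0 < kK k by rewrite muln_gt0 k0.
by move: (kK k) (dpar k c ^ c) (kM k c * kK k) (domnum _) (#|D|) hD h1 h2 h3 h4; clear; lia.
Qed.

Lemma no_case G k c : 2 < k -> ~ has_clique G k -> c * dpar k c ^ c < 3 * domnum (out_graph G k c).
Proof.
move=> k3 ncl; have k0 : 0 < k by lia.
case: (posnP c) => [->|c0].
  by rewrite mul0n muln_gt0 /= domnum_gt0 // /= /out_size eqxx addn1.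
have h : kM k c * kH k c <= domnum (out_graph G k c).
  apply: leq_domnum => D dom.
  set V := ncopy (kK k) (kH k c) (kq k c) (kPhi k c) (gn G).
  rewrite -[X in X * _]card_ord -sum_nat_const -sum1_card.
  apply: (@leq_trans (\sum_(cp < kM k c) \sum_(x in D | x %/ V == cp) 1)).
    apply: leq_sum => cp _; apply: leq_trans (copy_lower_bound k0 c0 dom ncl (ltn_ord cp)) _.
    by rewrite -sum1_card leq_eqVlt; apply/orP; left; apply/eqP/eq_bigl => x; rewrite inE.
  rewrite (exchange_big_dep (mem D)) /=; last by move=> cp x _ /andP[].
  apply: leq_sum => x xD; case: (ltnP (x %/ V) (kM k c)) => hx.
    by rewrite (big_pred1 (Ordinal hx)) // => cp; rewrite xD eq_sym.
  by rewrite big_pred0 // => cp; rewrite xD /= gtn_eqF // (leq_trans (ltn_ord cp)).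
have h1 := kK_leq k c0; have h2 : 0 < kK k by rewrite muln_gt0 k0.
have h3 := divn_eq (dpar k c ^ c) (kK k); have h4 := ltn_pmod (dpar k c ^ c) h2.
rewrite -/(kM k c) in h3.
(* Rounding loses less than [kK k], at most a thirtieth of d^c. *)
have h5 : dpar k c ^ c < 3 * (kM k c * kK k).
  by move: (kK k) (dpar k c ^ c) (kM k c * kK k) (_ %% _) h1 h2 h3 h4; clear; lia.
apply: (@leq_trans (c * (3 * (kM k c * kK k)))); first by rewrite ltn_pmul2l.
have -> : c * (3 * (kM k c * kK k)) = 3 * (kM k c * kH k c) by rewrite /kH; nia.
by rewrite leq_mul2l.
Qed.

(* gamma(G_c) < 1.1 d^c  <->  10 gamma < 11 d^c ;
   gamma(G_c) > c d^c / 3  <->  c d^c < 3 gamma. *)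
Theorem theorem4p1 :
  exists (M : TM) (a : nat) (f : nat -> nat -> nat),
    computable2 f /\
    forall (G : graph) (k c : nat), 3 <= k ->
      exists Gc : graph,
        outputs_within M (enc_input G k c)
          (f k c * (gsize G).+1 ^ (a * c.+1)) (enc_graph Gc) /\
        (has_clique G k -> 10 * domnum Gc < 11 * dpar k c ^ c) /\
        (~ has_clique G k -> c * dpar k c ^ c < 3 * domnum Gc).
Proof.
have [M [a [f [hf h]]]] := reduction_machine.
exists M, a, f; split=> // G k c k3; exists (out_graph G k c).
split; last by split; [apply: yes_case|apply: no_case].
rewrite enc_out_graph /enc_input /enc_graph -catA.
apply: outputs_within_leq (h _ _ _ _ (size_adj_bits G)).
rewrite leq_mul2l; apply/orP; right.
(* The machine achieves the fixed exponent [a], which is at most [a * c.+1]. *)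
apply: (@leq_trans ((gsize G).+1 ^ a)); last by rewrite leq_pexp2l // leq_pmulr.
by case: (a) => // u; rewrite leq_exp2r // ltnS leq_addr.
Qed.
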